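(* For every $n\ge1$ and every $j\ge1$, \[\Gamma_j(IA_n^+)=\Gamma_j(IA_n)\cap IA_n^+=\mathcal A_j\cap IA_n^+.\]
   Context: $F_n$ is free on the ordered basis $(x_1,\dots,x_n)$, $F_{i-1}=\langle x_1,\dots,x_{i-1}\rangle$, $x^y=y^{-1}xy$, $[x,y]=xyx^{-1}y^{-1}$, and $\Gamma_*$ is the lower central series ($\Gamma_1(G)=G$, $\Gamma_{k+1}(G)=[G,\Gamma_k(G)]$). $IA_n$ is the group of automorphisms of $F_n$ acting trivially on $F_n^{ab}$. The Andreadakis filtration: $\mathcal A_j$ is the subgroup of automorphisms $\sigma$ of $F_n$ with $\sigma(x)x^{-1}\in\Gamma_{j+1}(F_n)$ for all $x\in F_n$. $IA_n^+$ (triangular automorphisms) is the group of automorphisms $\varphi$ of $F_n$ such that for each $i$, $\varphi(x_i)=x_i^{w_i}\gamma_i$ with $w_i\in F_{i-1}$ and $\gamma_i\in\Gamma_2(F_{i-1})$. *)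

(* Defs.v *)
From mathcomp Require Import all_boot.
Set Implicit Arguments. Unset Strict Implicit. Unset Printing Implicit Defensive.

(* A "group" given by a product, a unit, and an inverse relation
   (isinv x y  <->  y is the inverse of x). *)
Record grp_ops (T : Type) := GrpOps {
  gmul : T -> T -> T;
  gone : T;
  ginv : T -> T -> Prop }.

Inductive gen (T : Type) (G : grp_ops T) (S : T -> Prop) : T -> Prop :=
| gen_one : gen G S (gone G)
| gen_S x : S x -> gen G S x
| gen_mul x y : gen G S x -> gen G S y -> gen G S (gmul G x y)
| gen_inv x y : gen G S x -> ginv G x y -> gen G S y.

Definition comm_set (T : Type) (G : grp_ops T) (S1 S2 : T -> Prop) (z : T) : Prop :=
  exists x y x' y', [/\ S1 x, S2 y, ginv G x x', ginv G y y'
                    & z = gmul G (gmul G (gmul G x y) x') y'].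

Fixpoint lcs_aux (T : Type) (G : grp_ops T) (S : T -> Prop) (k : nat) : T -> Prop :=
  match k with
  | 0 => S
  | k'.+1 => gen G (comm_set G S (lcs_aux G S k'))
  end.

(* Gamma j S : j-th term of the lower central series of the subgroup S,
   Gamma_1 = S, Gamma_{k+1} = [S, Gamma_k]  (for j >= 1). *)
Definition Gamma (T : Type) (G : grp_ops T) (j : nat) (S : T -> Prop) : T -> Prop :=
  lcs_aux G S j.-1.

Definition letter (n : nat) := ('I_n * bool)%type.  (* (i, false) = x_i, (i, true) = x_i^-1 *)
Definition linv n (a : letter n) : letter n := (a.1, ~~ a.2).

Definition push n (a : letter n) (w : seq (letter n)) : seq (letter n) :=
  if w is b :: w' then (if b == linv a then w' else a :: w) else [:: a].

Fixpoint reduced n (w : seq (letter n)) : bool :=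
  match w with
  | a :: ((b :: _) as w') => (b != linv a) && reduced w'
  | _ => true
  end.

Lemma reduced_tail n (a : letter n) w : reduced (a :: w) -> reduced w.
Proof. by case: w => [|b w] //= /andP[]. Qed.

Lemma push_reduced n (a : letter n) w : reduced w -> reduced (push a w).
Proof.
case: w => [|b w] //= Hw.
case: ifP => Hb; first exact: reduced_tail Hw.
by rewrite /= Hb Hw.
Qed.

Definition reduce n (w : seq (letter n)) : seq (letter n) := foldr (@push n) [::] w.

Lemma reduce_reduced n (w : seq (letter n)) : reduced (reduce w).
Proof. by elim: w => [|a w IH] //=; apply: push_reduced. Qed.

Definition FG (n : nat) := {w : seq (letter n) | reduced w}.

Definition fg_mul n (u v : FG n) : FG n :=
  exist _ (reduce (proj1_sig u ++ proj1_sig v)) (reduce_reduced _).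
Definition fg_inv n (u : FG n) : FG n :=
  exist _ (reduce (rev (map (@linv n) (proj1_sig u)))) (reduce_reduced _).
Definition fg_one n : FG n := exist _ [::] isT.
Definition fg_x n (i : 'I_n) : FG n := exist _ [:: (i, false)] isT.

Definition FGops (n : nat) : grp_ops (FG n) :=
  GrpOps (@fg_mul n) (fg_one n) (fun x y => y = fg_inv x).

Definition fg_conj n (x y : FG n) : FG n := fg_mul (fg_mul (fg_inv y) x) y.

(* F_i = < x_j : j < i >  (0-based, so the paper's F_{i-1} for x_i is Fsub i) *)
Definition Fsub n (i : nat) : FG n -> Prop :=
  gen (FGops n) (fun z => exists j : 'I_n, j < i /\ z = fg_x j).

Definition Ftop n : FG n -> Prop := fun _ => True.

Definition fg_hom n (f : FG n -> FG n) : Prop :=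
  forall x y, f (fg_mul x y) = fg_mul (f x) (f y).

Definition isAut n (f : FG n -> FG n) : Prop := fg_hom f /\ bijective f.

Definition AutOps (n : nat) : grp_ops (FG n -> FG n) :=
  GrpOps (fun f g => fun x => f (g x)) (fun x => x)
         (fun f g => cancel f g /\ cancel g f).

(* IA_n : acts trivially on F_n^ab, i.e. f(x) x^-1 in Gamma_2(F_n) *)
Definition IA n (f : FG n -> FG n) : Prop :=
  isAut f /\ forall x, Gamma (FGops n) 2 (@Ftop n) (fg_mul (f x) (fg_inv x)).

Definition Andreadakis n (j : nat) (f : FG n -> FG n) : Prop :=
  isAut f /\ forall x, Gamma (FGops n) j.+1 (@Ftop n) (fg_mul (f x) (fg_inv x)).

Definition IAplus n (f : FG n -> FG n) : Prop :=
  isAut f /\ forall i : 'I_n, exists w g,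
    [/\ @Fsub n i w, Gamma (FGops n) 2 (@Fsub n i) g
      & f (fg_x i) = fg_mul (fg_conj (fg_x i) w) g].

(* Main.v *)
Require Import Defs.
From HB Require Import structures.
From mathcomp Require Import all_boot all_algebra.
From mathcomp Require Import boolp functions zify.
Set Implicit Arguments. Unset Strict Implicit. Unset Printing Implicit Defensive.

(* Only the inclusion of [A_j] intersected with [IA_n^+] in [Gamma_j (IA_n^+)] is not formal.
   Write [k_w : x_m |-> x_m^w] and [t_c : x_m |-> x_m c], both fixing the other generators.  A
   triangular [f] with [f x_m = x_m^(w_m) c_m] is a product of the [k_(w_m) t_(c_m)].  If [f] lies
   in [A_j], killing [x_m] gives [c_m] in [Gamma_(j+1) (F_(m-1))], whence [[w_m^-1, x_m]] lies in
   [Gamma_(j+1) (F_n)].  In the Magnus expansion this forces the coefficients of [w_m] in degrees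
   [1, ..., j-1] to vanish, because [x_m] does not occur in [w_m]; so [w_m] lies in [Gamma_j] by
   Magnus's theorem.  Then [k_(w_m)] and [t_(c_m)] lie in [Gamma_j (IA_n^+)], the latter since
   [[k_v, t_c] = t_[v, c]].

   Magnus's theorem amounts to the injectivity of the free Lie ring into the free associative
   ring over the integers.  This is proved by Lazard elimination: a Lie polynomial in which every
   monomial involves the letter [x] is rewritten in the letters [ad(x)^i y], [y <> x], which lowers
   the number of leaves, and the vanishing of its associative image is transported along. *)

(** * Lower central series *)

(* [gops (FG n)] is convertible to [FGops n]. *)
Definition gops (G : groupType) : grp_ops G :=
  GrpOps (fun x y : G => x * y)%g 1%g (fun x y => y = x^-1)%g.

Section LowerCentralSeries.
Local Open Scope group_scope.
Variable G : groupType.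
Implicit Types (x y z a b c : G) (S : G -> Prop).

Definition cmg x y := x * y * x^-1 * y^-1.

Lemma cmg_mull x y z : cmg (x * y) z = x * cmg y z * x^-1 * cmg x z.
Proof. by rewrite /cmg !gnorm. Qed.
Lemma cmg_mulr x y z : cmg x (y * z) = cmg x y * (y * cmg x z * y^-1).
Proof. by rewrite /cmg !gnorm. Qed.
Lemma cmg_inv x y : (cmg x y)^-1 = cmg y x.
Proof. by rewrite /cmg !gnorm. Qed.
Lemma cmg_invl x y : cmg x^-1 y = x^-1 * (cmg x y)^-1 * x.
Proof. by rewrite /cmg !gnorm. Qed.
Lemma morph_one_inv (H : groupType) (f : G -> H) :
  (forall x y, f (x * y) = f x * f y) -> f 1 = 1 /\ (forall x, f x^-1 = (f x)^-1).
Proof.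
move=> fM; have f1 : f 1 = 1 by apply: (mulgI (f 1)); rewrite -fM !mulg1.
by split=> // x; apply: (mulgI (f x)); rewrite -fM !mulgV.
Qed.

Definition subgrp S := [/\ S 1, forall x y, S x -> S y -> S (x * y) & forall x, S x -> S x^-1].

Lemma gen_subgrp S : subgrp (gen (gops G) S).
Proof.
split; [exact: gen_one | by move=> x y; apply: gen_mul |].
by move=> x Sx; apply: gen_inv Sx _.
Qed.

Lemma gen_min S S' : subgrp S' -> (forall x, S x -> S' x) -> forall x, gen (gops G) S x -> S' x.
Proof.
move=> [S1 SM SV] sub x; elim=> {x} [|x /sub|x y _ Sx _ Sy|x y _ Sx ->] //.
  exact: SM.
exact: SV.
Qed.

Local Notation lcs := (lcs_aux (gops G)).

Lemma lcs_subgrp S k : subgrp S -> subgrp (lcs S k).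
Proof. by case: k => [|k] //= _; apply: gen_subgrp. Qed.

Lemma comm_setE S1 S2 z :
  comm_set (gops G) S1 S2 z <-> exists x y, [/\ S1 x, S2 y & z = cmg x y].
Proof.
split=> [[x [y [_ [_ [? ? /= -> -> ->]]]]]|[x [y [? ? ->]]]]; first by exists x, y.
by exists x, y, x^-1, y^-1.
Qed.

Lemma lcs_cmg S k x y : S x -> lcs S k y -> lcs S k.+1 (cmg x y).
Proof. by move=> Sx Sy; apply/gen_S/comm_setE; exists x, y. Qed.

(** Indices are shifted: [L k] is $\Gamma_{k+1}(G)$, so [L 0] is the whole group and commutators
    take [L i] and [L j] to [L (i + j).+1]. *)
Local Notation L := (lcs (fun=> True)).

Lemma L_subgrp k : subgrp (L k). Proof. exact: lcs_subgrp. Qed.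
Lemma lcs_sub S k x : subgrp S -> lcs S k x -> S x.
Proof.
move=> Ssub; elim: k x => //= k IH; apply: gen_min => // _ /comm_setE[a [c [Sa /IH Sc ->]]].
by case: Ssub => _ SM SV; rewrite /cmg; do 3?[apply: (SM)]; rewrite //; apply: SV.
Qed.

Lemma L1 k : L k 1. Proof. by case: (L_subgrp k). Qed.
Lemma LM k x y : L k x -> L k y -> L k (x * y). Proof. by case: (L_subgrp k) => _ + _; apply. Qed.
Lemma LV k x : L k x -> L k x^-1. Proof. by case: (L_subgrp k) => _ _; apply. Qed.

Lemma LJ k a x : L k x -> L k (a * x * a^-1).
Proof.
have fM x' y' : a * (x' * y') * a^-1 = a * x' * a^-1 * (a * y' * a^-1) by rewrite !gnorm.
have [f1 fV] := morph_one_inv fM.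
elim: k => [//|k IH] in x *.
apply: (@gen_min _ (fun x => L k.+1 (a * x * a^-1))) => [|{}x /comm_setE[b [c [_ Lc ->]]]].
  split; first by rewrite f1; apply: L1.
    by move=> {}x y Lx Ly; rewrite fM; apply: LM.
  by move=> {}x Lx; rewrite fV; apply: LV.
have -> : a * cmg b c * a^-1 = cmg (a * b * a^-1) (a * c * a^-1) by rewrite /cmg !gnorm.
exact/lcs_cmg/IH.
Qed.

Lemma LJV k a x : L k x -> L k (a^-1 * x * a).
Proof. by move/(LJ a^-1); rewrite invgK. Qed.

Lemma LS k x : L k.+1 x -> L k x.
Proof.
apply: gen_min (L_subgrp k) _ _ => _ /comm_setE[a [c [_ Lc ->]]].
by apply: LM; [apply: LJ | apply: LV].
Qed.

Lemma Lle k l x : l <= k -> L k x -> L l x.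
Proof.
move=> /subnK<-; elim: (k - l) => [//|m IH]; rewrite addSn => /LS; exact: IH.
Qed.

Lemma L_cmg0 k x y : L k y -> L k.+1 (cmg x y).
Proof. exact: lcs_cmg. Qed.

(** The Hall-Witt identity, solved for the factor that brackets [a] with [c] first; the other two
    bracket [z] with [c] or [a] first. *)
Lemma hall_witt a c z :
  cmg (cmg a c)^-1 z^-1 = c * (z^-1 * cmg (cmg c^-1 z)^-1 a * z *
     (a * cmg (cmg z^-1 a^-1)^-1 c^-1 * a^-1))^-1 * c^-1.
Proof. by rewrite /cmg !gnorm. Qed.

(** The three subgroups argument: induction on [i], with Hall-Witt moving the outer element [a] of a
    generator [cmg a c] onto the other side. *)
Lemma L_cmg i j x y : L i x -> L j y -> L (i + j).+1 (cmg x y).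
Proof.
elim: i j x y => [|i IH] j x y; first by move=> _; apply: L_cmg0.
move=> + Ly; move: x.
apply: (@gen_min _ (fun x => L _ (cmg x y))) => [|x /comm_setE[a [c [_ Lc ->]]]].
  split=> [|x x' Lx Lx'|x Lx]; first by rewrite /cmg !gnorm; apply: L1.
    by rewrite cmg_mull; apply: LM => //; apply: LJ.
  by rewrite cmg_invl; move: (LJ x^-1 (LV Lx)); rewrite invgK.
(* Hall-Witt speaks of inverses, so the claim is first transferred to them; this costs only
   conjugations and inversions. *)
suff /(_ y^-1 (LV Ly)) : forall z, L j z -> L (i.+1 + j).+1 (cmg (cmg a c)^-1 z^-1).
  rewrite invgK; move: (cmg a c) => m; rewrite cmg_invl => H.
  have -> : cmg m y = m * (m^-1 * (cmg m y)^-1 * m)^-1 * m^-1 by rewrite /cmg !gnorm.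
  exact/LJ/LV.
move=> z Lz; rewrite hall_witt; apply/LJ/LV/LM.
  apply: LJV; rewrite -cmg_inv; apply/LV.
  by apply: L_cmg0; apply/LV; apply: IH => //; apply: LV.
(* Here [z] has already been bracketed with [a], so the induction hypothesis is used at [j.+1]. *)
apply/LJ; rewrite -cmg_inv; apply/LV; rewrite addSn -addnS; apply: IH; first exact: LV.
by rewrite cmg_inv; apply/L_cmg0/LV.
Qed.

Definition eqm k x y := L k (x * y^-1).

Lemma eqm_refl k x : eqm k x x. Proof. by rewrite /eqm mulgV; apply: L1. Qed.
Lemma eqm_sym k x y : eqm k x y -> eqm k y x.
Proof. by move=> /LV; rewrite /eqm !gnorm. Qed.
Lemma eqm_trans k y x z : eqm k x y -> eqm k y z -> eqm k x z.
Proof. by move=> xy yz; move: (LM xy yz); rewrite /eqm !gnorm. Qed.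
Lemma eqmM k x x' y y' : eqm k x x' -> eqm k y y' -> eqm k (x * y) (x' * y').
Proof.
rewrite /eqm => ex ey; have -> : x * y * (x' * y')^-1 = x * (y * y'^-1) * x^-1 * (x * x'^-1).
  by rewrite !gnorm.
by apply: LM => //; apply: LJ.
Qed.
Lemma eqmV k x x' : eqm k x x' -> eqm k x^-1 x'^-1.
Proof.
rewrite /eqm => /LV/(LJ x^-1); by rewrite !gnorm.
Qed.
Lemma eqmC k a x : L k x -> eqm k.+1 (a * x) (x * a).
Proof. by rewrite /eqm invgM !mulgA => Lx; apply: L_cmg0. Qed.
Lemma eqm_conj k a x : L k x -> eqm k.+1 (a * x * a^-1) x.
Proof. exact: L_cmg0. Qed.
Lemma eqm1 k x : eqm k x 1 <-> L k x. Proof. by rewrite /eqm invg1 mulg1. Qed.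
Lemma eqm_mem k x y : eqm k x y -> L k y -> L k x.
Proof. by move=> e /eqm1 /(eqm_trans e)/eqm1. Qed.

Lemma eqm_swap k p c q : L k q -> eqm k.+1 (p * c * q * c^-1) (q * p).
Proof.
move=> Lq; rewrite -!mulgA; apply: (eqm_trans (y := p * q)); last exact: eqmC.
by apply: (eqmM (eqm_refl _ _)); rewrite mulgA; apply: eqm_conj.
Qed.

(** This and the next congruences say that commutators induce a well-defined biadditive bracket on
    the quotients $\Gamma_{k+1}/\Gamma_{k+2}$. *)
Lemma cmgMl_eqm i j x x' y : L i x -> L i x' -> L j y ->
  eqm (i + j).+2 (cmg (x * x') y) (cmg x y * cmg x' y).
Proof.
move=> Lx Lx' Ly; rewrite cmg_mull.
apply: (eqm_trans (y := cmg x' y * cmg x y)); last exact/eqmC/L_cmg.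
by apply: (fun e => eqmM e (eqm_refl _ _)); apply/eqm_conj/L_cmg.
Qed.

Lemma cmgVl_eqm i j x y : L i x -> L j y -> eqm (i + j).+2 (cmg x^-1 y) (cmg x y)^-1.
Proof.
move=> Lx Ly; rewrite cmg_invl.
by move: (eqm_conj x^-1 (LV (L_cmg Lx Ly))); rewrite invgK.
Qed.

Lemma cmg_eqml i j x x' y : eqm i x x' -> L j y -> eqm (i + j).+1 (cmg x y) (cmg x' y).
Proof.
move=> ex Ly; rewrite -[x](mulgVK x') cmg_mull -[X in eqm _ _ X]mulg1.
apply: eqmM; last by apply/eqm1; apply: L_cmg.
by apply: Lle (L_cmg ex (L_cmg0 x' Ly)); rewrite addnS.
Qed.

Lemma cmg_eqmr i j x x' y : eqm i x x' -> L j y -> eqm (i + j).+1 (cmg y x) (cmg y x').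
Proof. by move=> ex Ly; rewrite -cmg_inv -[cmg y x']cmg_inv; apply/eqmV/cmg_eqml. Qed.

(** Conjugation by [x] turns [y] into [a * y] and [z] into [b * z], hence [c] into
    [cmg (a * y) (b * z)]. In its expansion only [cmg y b], [c] and [cmg a z] survive modulo
    [L d]. *)
Lemma cmg_jacobi_eqm i j l x y z : L i x -> L j y -> L l z ->
  eqm (i + (j + l).+1).+2 (cmg x (cmg y z)) (cmg (cmg x y) z * cmg y (cmg x z)).
Proof.
move=> Lx Ly Lz; set d := _.+2.
set a := cmg x y; set b := cmg x z; set c := cmg y z.
have La : L (i + j).+1 a by apply: L_cmg.
have Lb : L (i + l).+1 b by apply: L_cmg.
have Lc : L (j + l).+1 c by apply: L_cmg.
have Lyb : L d.-1 (cmg y b).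
  by have := L_cmg Ly Lb; congr (L _ _); rewrite /d /=; lia.
have Laz : L d.-1 (cmg a z).
  by have := L_cmg La Lz; congr (L _ _); rewrite /d /=; lia.
have -> : cmg x c = cmg (a * y) (b * z) * c^-1.
  by rewrite /c /a /b /cmg !gnorm.
apply: (eqm_trans (y := cmg y b * c * cmg a z * c^-1)); last first.
  exact: (eqm_swap _ _ Laz).
apply: (fun e => eqmM e (eqm_refl _ _)); rewrite cmg_mull; apply: eqmM.
  rewrite cmg_mulr; have -> : a * (cmg y b * (b * cmg y z * b^-1)) * a^-1 =
    (a * cmg y b * a^-1) * (cmg a (cmg b c) * cmg b c * cmg a c * c).
    by rewrite -/c /cmg !gnorm.
  apply: eqmM; first exact: (eqm_conj _ Lyb).
  rewrite -[X in eqm _ _ X]mul1g; apply: (fun e => eqmM e (eqm_refl _ _)); apply/eqm1.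
  have Lbc : L d (cmg b c).
    by apply: Lle (L_cmg Lb Lc); rewrite /d; lia.
  apply: LM; last by apply: Lle (L_cmg La Lc); rewrite /d; lia.
  by apply: LM => //; apply/LS/L_cmg0.
rewrite cmg_mulr -[X in eqm _ _ X]mul1g; apply: eqmM; last exact: (eqm_conj _ Laz).
by apply/eqm1; apply: Lle (L_cmg La Lb); rewrite /d; lia.
Qed.
End LowerCentralSeries.

Lemma lcs_hom (G H : groupType) (f : G -> H) (S : G -> Prop) (S' : H -> Prop) k x :
    (forall x y, f (x * y) = f x * f y)%g -> subgrp S' -> (forall x, S x -> S' (f x)) ->
  lcs_aux (gops G) S k x -> lcs_aux (gops H) S' k (f x).
Proof.
move=> fM S'P fS; have [f1 fV] := morph_one_inv fM.
elim: k x => [|k IH]; first exact: fS.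
have [S1 SM SV] := lcs_subgrp k.+1 S'P.
apply: (@gen_min _ _ (fun x => lcs_aux (gops H) S' k.+1 (f x)));
  last move=> _ /comm_setE[a [c [Sa Sc ->]]].
  split=> [|x y Sx Sy|x Sx]; first by rewrite f1.
    by rewrite fM; apply: SM.
  by rewrite fV; apply: SV.
have -> : f (cmg a c) = cmg (f a) (f c) by rewrite /cmg !fM !fV.
by apply: lcs_cmg; [apply: fS | apply: IH].
Qed.

Import GRing.Theory.
Local Open Scope ring_scope.

(** * Free Lie rings embed in free associative rings *)

Definition sgn (V : zmodType) (b : bool) (v : V) : V := if b then - v else v.

(** Signed lists stand for elements of the free abelian group on [I], [true] being a minus sign;
    [ssum] is the additive extension of [F]. *)
Definition ssum (I : Type) (V : zmodType) (u : seq (bool * I)) (F : I -> V) : V :=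
  \sum_(p <- u) sgn p.1 (F p.2).

Definition additive_fun (V W : zmodType) (f : V -> W) := forall x y, f (x - y) = f x - f y.

Section AdditiveFun.
Variables (V W : zmodType) (f : V -> W).
Hypothesis fB : additive_fun f.
Lemma additive_fun0 : f 0 = 0. Proof. by rewrite -{1}(subr0 0) fB subrr. Qed.
Lemma additive_funN x : f (- x) = - f x.
Proof. by rewrite -sub0r fB additive_fun0 sub0r. Qed.
Lemma additive_funD x y : f (x + y) = f x + f y.
Proof. by rewrite -{1}[y]opprK fB additive_funN opprK. Qed.
End AdditiveFun.

Section SignedSums.
Variable V : zmodType.
Implicit Types (v : V) (b : bool).

Lemma sgn0 b : sgn b (0 : V) = 0. Proof. by case: b => //=; rewrite oppr0. Qed.
Lemma sgnN b v : sgn (~~ b) v = - sgn b v. Proof. by case: b => //=; rewrite opprK. Qed.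
Lemma sgn_add (W : zmodType) (f : V -> W) b v :
  additive_fun f -> f (sgn b v) = sgn b (f v).
Proof. by move=> fB; case: b => //=; apply: additive_funN. Qed.

Lemma ssum0 I (u : seq (bool * I)) : ssum u (fun=> 0 : V) = 0.
Proof. by apply: big1 => p _; rewrite sgn0. Qed.
Lemma ssum_nil I (F : I -> V) : ssum [::] F = 0. Proof. exact: big_nil. Qed.
Lemma ssum_cons I p (u : seq (bool * I)) (F : I -> V) :
  ssum (p :: u) F = sgn p.1 (F p.2) + ssum u F.
Proof. exact: big_cons. Qed.
Lemma ssum_cat I (u w : seq (bool * I)) (F : I -> V) :
  ssum (u ++ w) F = ssum u F + ssum w F.
Proof. exact: big_cat. Qed.
Lemma eq_ssum I (u : seq (bool * I)) (F F' : I -> V) : F =1 F' -> ssum u F = ssum u F'.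
Proof. by move=> e; apply: eq_bigr => p _; rewrite e. Qed.

Lemma ssumf (W : zmodType) (f : V -> W) I (u : seq (bool * I)) (F : I -> V) :
  additive_fun f -> f (ssum u F) = ssum u (f \o F).
Proof.
move=> fB; rewrite /ssum (big_morph f (additive_funD fB) (additive_fun0 fB)); apply: eq_bigr => p _; exact: sgn_add.
Qed.

Lemma ssumD I (u : seq (bool * I)) (F F' : I -> V) :
  ssum u (fun i => F i + F' i) = ssum u F + ssum u F'.
Proof.
rewrite /ssum -big_split; apply: eq_bigr => p _ /=.
by case: p.1 => //=; rewrite opprD.
Qed.
Lemma ssumN I (u : seq (bool * I)) (F : I -> V) : ssum u (fun i => - F i) = - ssum u F.
Proof. by rewrite -ssumf // => x y; rewrite !opprD. Qed.
Lemma ssumB I (u : seq (bool * I)) (F F' : I -> V) :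
  ssum u (fun i => F i - F' i) = ssum u F - ssum u F'.
Proof. by rewrite ssumD ssumN. Qed.

Definition negs I (u : seq (bool * I)) := [seq (~~ p.1, p.2) | p <- u].
Lemma ssum_negs I (u : seq (bool * I)) (F : I -> V) : ssum (negs u) F = - ssum u F.
Proof.
elim: u => [|p u IH]; first by rewrite !ssum_nil oppr0.
by rewrite /= !ssum_cons IH sgnN opprD.
Qed.

Definition smap I J (g : I -> J) (u : seq (bool * I)) := [seq (p.1, g p.2) | p <- u].
Lemma ssum_smap I J (g : I -> J) u (F : J -> V) : ssum (smap g u) F = ssum u (F \o g).
Proof. by rewrite /ssum big_map. Qed.

Definition sbind I J (u : seq (bool * I)) (g : I -> seq (bool * J)) : seq (bool * J) :=
  flatten [seq [seq (p.1 (+) q.1, q.2) | q <- g p.2] | p <- u].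
Lemma ssum_sbind I J u (g : I -> seq (bool * J)) (F : J -> V) :
  ssum (sbind u g) F = ssum u (fun i => ssum (g i) F).
Proof.
elim: u => [|p u IH]; first by rewrite /sbind /= !ssum_nil.
rewrite /sbind /= ssum_cat -/(sbind u g) IH ssum_cons; congr (_ + _).
rewrite /ssum big_map /=; case: p.1 => /=; last by [].
by rewrite -sumrN; apply: eq_bigr => q _; case: q.1 => /=; rewrite ?opprK.
Qed.

Lemma ssum_sum I J (r : seq J) (u : seq (bool * I)) (F : J -> I -> V) :
  ssum u (fun i => \sum_(j <- r) F j i) = \sum_(j <- r) ssum u (F j).
Proof.
elim: r => [|j r IH].
  rewrite big_nil; apply: etrans (ssum0 u); apply: eq_ssum => i; exact: big_nil.
by rewrite big_cons -IH -ssumD; apply: eq_ssum => i; rewrite big_cons.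
Qed.
End SignedSums.

Lemma ssum_filter_all I (V : zmodType) (P : pred I) (u : seq (bool * I)) (F : I -> V) :
  ssum [seq p <- u | P p.2] F + ssum [seq p <- u | ~~ P p.2] F = ssum u F.
Proof. by rewrite /ssum !big_filter [RHS](bigID (fun p => P p.2)). Qed.

(** Grouping the terms by basis element turns the sum into one of coefficients times values, and all
    coefficients are zero. *)
Lemma ssum_free (B : eqType) (V : zmodType) (l : seq (bool * B)) (F : B -> V) :
  (forall b, ssum l (fun b' => (b' == b)%:R : int) = 0) -> ssum l F = 0.
Proof.
move=> H; set s := undup (map snd l).
have -> : ssum l F = ssum l (fun b' => \sum_(b <- s) F b *~ (b' == b)%:R).
  rewrite /ssum; apply: eq_big_seq => p pl; congr (sgn _ _).
  have ps : p.2 \in s by rewrite mem_undup map_f.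
  rewrite (bigD1_seq p.2) ?undup_uniq //= eqxx mulr1z big1 ?addr0 // => b.
  by rewrite eq_sym => /negPf->; rewrite mulr0z.
rewrite ssum_sum big1_seq // => b _.
rewrite -(ssumf (f := fun c => F b *~ c)) ?H ?mulr0z // => x y.
by rewrite mulrzBr.
Qed.

Definition alls I (P : pred I) (u : seq (bool * I)) := all (fun p => P p.2) u.

Lemma alls_cat I (P : pred I) u w : alls P (u ++ w) = alls P u && alls P w.
Proof. exact: all_cat. Qed.

Lemma alls_negs I (P : pred I) u : alls P (negs u) = alls P u.
Proof. by rewrite /alls all_map; apply: eq_all. Qed.

Lemma alls_smap I J (P : pred J) (g : I -> J) u : alls P (smap g u) = alls (P \o g) u.
Proof. by rewrite /alls all_map; apply: eq_all. Qed.

Lemma alls_sbind I J (P : pred I) (R : pred J) u (g : I -> seq (bool * J)) :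
  alls P u -> (forall i, P i -> alls R (g i)) -> alls R (sbind u g).
Proof.
move=> + H; elim: u => [//|p u IH] /= /andP[Pp /IH Ru].
rewrite /sbind /= /alls all_cat; apply/andP; split=> //.
rewrite all_map; apply: etrans (H _ Pp); exact: eq_all.
Qed.

Lemma sub_alls I (P R : pred I) u : (forall i, P i -> R i) -> alls P u -> alls R u.
Proof. by move=> H; apply: sub_all => p; apply: H. Qed.

Lemma alls_and I (P R : pred I) u : alls P u -> alls R u -> alls (fun i => P i && R i) u.
Proof. by move=> Pu Ru; rewrite /alls all_predI; apply/andP. Qed.

Lemma eq_ssum_alls I (V : zmodType) (P : pred I) (u : seq (bool * I)) (F F' : I -> V) :
  alls P u -> (forall i, P i -> F i = F' i) -> ssum u F = ssum u F'.
Proof.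
move=> + H; elim: u => [|p u IH] /=; first by rewrite !ssum_nil.
by case/andP=> /H Pp /IH; rewrite !ssum_cons Pp => ->.
Qed.

(* The degree [k] part of a graded Lie ring is the image of [homog k] in [comp k]; the bracket
   is only defined on representatives and maps degrees [i] and [j] to [(i + j).+1], so that
   degree [k] is weight [k.+1].  [br_lin] packages well-definedness and additivity. *)
Record gradedLie := GradedLie {
  car :> Type;
  homog : nat -> car -> Prop;
  br : car -> car -> car;
  comp : nat -> zmodType;
  pr : forall k, car -> comp k;
  mem_br : forall i j x y, homog i x -> homog j y -> homog (i + j).+1 (br x y);
  br_lin : forall I (l : seq (bool * I)) (P : pred I) (F : I -> car) i j d x y,
    d = (i + j).+1 -> homog i x -> homog j y ->
    alls P l -> (forall t, P t -> homog i (F t)) -> pr i x = ssum l (fun t => pr i (F t)) ->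
    pr d (br x y) = ssum l (fun t => pr d (br (F t) y));
  br_anti : forall i j d x y, d = (i + j).+1 -> homog i x -> homog j y ->
    pr d (br x y) = - pr d (br y x);
  br_alt : forall i x, homog i x -> pr (i + i).+1 (br x x) = 0;
  br_jac : forall i j l d x y z, d = (i + j + l).+2 -> homog i x -> homog j y -> homog l z ->
    pr d (br x (br y z)) = pr d (br (br x y) z) + pr d (br y (br x z)) }.

Inductive tree (A : Type) := Leaf of A | Node of tree A & tree A.

Fixpoint leaves A (t : tree A) : seq A :=
  match t with Leaf a => [:: a] | Node s t => leaves s ++ leaves t end.

Fixpoint wtT A (wt : A -> nat) (t : tree A) : nat :=
  match t with Leaf a => wt a | Node s t => (wtT wt s + wtT wt t).+1 end.

Fixpoint evT A (L : gradedLie) (phi : A -> L) (t : tree A) : L :=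
  match t with Leaf a => phi a | Node s t => br (evT phi s) (evT phi t) end.

Section GradedLie.
Variable L : gradedLie.
Implicit Types x y z : L.

Lemma br_linr I (l : seq (bool * I)) (P : pred I) (F : I -> L) i j d x y :
    d = (i + j).+1 -> homog i x -> homog j y ->
    alls P l -> (forall t, P t -> homog j (F t)) -> pr j y = ssum l (fun t => pr j (F t)) ->
  pr d (br x y) = ssum l (fun t => pr d (br x (F t))).
Proof.
move=> dE xi yj Pl mF eq_y; rewrite (br_anti dE xi yj); rewrite addnC in dE.
rewrite (br_lin dE yj xi Pl mF eq_y) -ssumN; apply: eq_ssum_alls Pl _ => t Pt.
by rewrite (br_anti dE (mF _ Pt) xi) opprK.
Qed.

Lemma mem_evT (A : Type) (wt : A -> nat) (phi : A -> L) :
  (forall a, homog (wt a) (phi a)) -> forall t, homog (wtT wt t) (evT phi t).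
Proof. by move=> H; elim=> //= s IHs t IHt; apply: mem_br. Qed.
End GradedLie.

Section Elimination.
Variables (A : eqType) (x : A).
(* [(y, i)] stands for [ad(x)^i y]. *)
Definition letter' := ({y : A | y != x} * nat)%type.

(** The derivation $\mathrm{ad}(x)$ on bracketings in the new letters, by the Leibniz rule. *)
Fixpoint DT (t' : tree letter') : seq (bool * tree letter') :=
  match t' with
  | Leaf (y, i) => [:: (false, Leaf (y, i.+1))]
  | Node s' t' => smap (fun u => Node u t') (DT s') ++ smap (Node s') (DT t')
  end.

Definition is_x (t : tree A) := if t is Leaf a then a == x else false.

(** Rewrites a bracketing in the letters $\mathrm{ad}(x)^i y$. The single leaf [x] cannot be so
    expressed; its value [[::]] is a default, excluded below by [~~ is_x x t]. *)
Fixpoint elim_tree (t : tree A) : seq (bool * tree letter') :=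
  match t with
  | Leaf a => if insub a is Some y then [:: (false, Leaf (y, 0))] else [::]
  | Node s t => if is_x s then (if is_x t then [::] else sbind (elim_tree t) DT)
                else if is_x t then negs (sbind (elim_tree s) DT)
                else sbind (elim_tree s) (fun s' => smap (Node s') (elim_tree t))
  end.

Lemma DT_size t' : alls (fun t => size (leaves t) == size (leaves t')) (DT t').
Proof.
elim: t' => [[y i]//|s' IHs t' IHt] /=.
rewrite alls_cat !alls_smap /=; apply/andP; split.
  by apply: sub_alls IHs => u /eqP /= e; rewrite !size_cat e.
by apply: sub_alls IHt => u /eqP /= e; rewrite !size_cat e.
Qed.

(** Each occurrence of [x] is absorbed into the exponent of a new letter. This loss of leaves drives
    the induction for injectivity. *)
Lemma elim_tree_size t : ~~ is_x t ->
  alls (fun t' => size (leaves t') + count_mem x (leaves t) == size (leaves t))%N (elim_tree t).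
Proof.
elim: t => [a /=|s IHs t IHt _ /=].
  by move=> ax; rewrite insubT /alls /= (negPf ax).
rewrite count_cat size_cat; case: ifP => [|/negbT sx].
  case: s {IHs} => //= a /eqP ->; rewrite eqxx.
  case: ifP => // /negbT /IHt H; apply: alls_sbind H _ => t' /eqP <-.
  by apply: sub_alls (DT_size t') => u /eqP ->; rewrite addnCA.
case: ifP => [|/negbT tx].
  case: t {IHt} => //= a /eqP ->; rewrite eqxx alls_negs.
  apply: alls_sbind (IHs sx) _ => t' /eqP <-.
  by apply: sub_alls (DT_size t') => u /eqP ->; rewrite addn0 addnA.
apply: alls_sbind (IHs sx) _ => s' /eqP <-; rewrite alls_smap.
apply: sub_alls (IHt tx) => t' /eqP /= <-.
by rewrite size_cat addnACA.
Qed.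

Variable wt : A -> nat.
(** The weight of $\mathrm{ad}(x)^i y$: with shifted degrees, each bracketing with [x] adds
    [(wt x).+1]. *)
Definition wt' (b : letter') := (wt (val b.1) + b.2 * (wt x).+1)%N.

Lemma DT_wt t' : alls (fun t => wtT wt' t == (wt x + wtT wt' t').+1) (DT t').
Proof.
elim: t' => [[y i]|s' IHs t' IHt] /=.
  by rewrite /alls /= /wt' /= andbT; apply/eqP; lia.
rewrite alls_cat !alls_smap /=; apply/andP; split.
  by apply: sub_alls IHs => u /eqP /= ->; apply/eqP; lia.
by apply: sub_alls IHt => u /eqP /= ->; apply/eqP; lia.
Qed.

Lemma elim_tree_wt t : ~~ is_x t -> alls (fun t' => wtT wt' t' == wtT wt t) (elim_tree t).
Proof.
elim: t => [a /=|s IHs t IHt _ /=].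
  by move=> ax; rewrite insubT /alls /= /wt' /= mul0n addn0 eqxx.
case: ifP => [|/negbT sx].
  case: s {IHs} => //= a /eqP ->.
  case: ifP => // /negbT /IHt H; apply: alls_sbind H _ => t' /eqP <-.
  exact: DT_wt.
case: ifP => [|/negbT tx].
  case: t {IHt} => //= a /eqP ->; rewrite alls_negs.
  apply: alls_sbind (IHs sx) _ => t' /eqP <-.
  by apply: sub_alls (DT_wt t') => u /eqP ->; rewrite addnC.
apply: alls_sbind (IHs sx) _ => s' /eqP <-; rewrite alls_smap.
by apply: sub_alls (IHt tx) => t' /eqP /= <-.
Qed.

Variables (L : gradedLie) (phi : A -> L).
Hypothesis phi_mem : forall a, homog (wt a) (phi a).
Definition phi' (b : letter') : L := iter b.2 (br (phi x)) (phi (val b.1)).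

Lemma phi'_mem b : homog (wt' b) (phi' b).
Proof.
case: b => y i; rewrite /wt' /phi' /=; elim: i => [|i IH].
  by rewrite mul0n addn0.
rewrite iterS mulSn addSn addnS addnCA.
exact: mem_br.
Qed.
Let mem' := mem_evT phi'_mem.

Lemma DT_ev t' d : d = (wt x + wtT wt' t').+1 ->
  pr d (br (phi x) (evT phi' t')) = ssum (DT t') (fun t => pr d (evT phi' t)).
Proof.
elim: t' d => [[y i]|s' IHs t' IHt] d dE.
  by rewrite /= ssum_cons ssum_nil /= addr0.
rewrite [evT _ _]/= [DT _]/= ssum_cat !ssum_smap.
rewrite (br_jac (i := wt x) (j := wtT wt' s') (l := wtT wt' t')) //; last by rewrite dE /=; lia.
congr (_ + _).
  apply: (br_lin (i := (wt x + wtT wt' s').+1) (j := wtT wt' t') _ _ _ (DT_wt s')) => //.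
  - by rewrite dE /=; lia.
  - exact: mem_br.
  - by move=> t /eqP <-.
  - exact: IHs.
apply: (br_linr (i := wtT wt' s') (j := (wt x + wtT wt' t').+1) _ _ _ (DT_wt t')) => //.
- by rewrite dE /=; lia.
- exact: mem_br.
- by move=> t /eqP <-.
- exact: IHt.
Qed.

(** The rewriting is valid in any graded Lie ring: [[x, t]] by the Jacobi identity ([DT_ev]),
    [[s, x]] by antisymmetry, [[x, x]] by alternation, and the rest by bilinearity. *)
Lemma elim_tree_ev t : ~~ is_x t ->
  pr (wtT wt t) (evT phi t) = ssum (elim_tree t) (fun t' => pr (wtT wt t) (evT phi' t')).
Proof.
have mem0 := mem_evT phi_mem.
elim: t => [a /=|s IHs t IHt _].
  by move=> ax; rewrite insubT ssum_cons ssum_nil addr0.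
have mE u : ~~ is_x u -> forall u', wtT wt' u' == wtT wt u -> homog (wtT wt u) (evT phi' u').
  by move=> _ u' /eqP <-.
rewrite [elim_tree _]/=; case: ifP => [|/negbT sx].
  case: s {IHs} => //= a /eqP ->.
  case: ifP => [|/negbT tx].
    case: t {IHt} => //= b /eqP ->; rewrite ssum_nil; exact: br_alt.
  rewrite ssum_sbind.
  rewrite (br_linr (erefl _) _ _ (elim_tree_wt tx) (mE _ tx) (IHt tx)) //.
  by apply: (eq_ssum_alls (elim_tree_wt tx)) => t' /eqP e; apply: DT_ev; rewrite e.
case: ifP => [|/negbT tx].
  case: t {IHt} => //= a /eqP ->; rewrite ssum_negs ssum_sbind -ssumN.
  rewrite (br_lin (erefl _) _ _ (elim_tree_wt sx) (mE _ sx) (IHs sx)) //.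
  apply: (eq_ssum_alls (elim_tree_wt sx)) => s' /eqP e.
  rewrite (br_anti (i := wtT wt s) (j := wt x)) //; last exact/mE/eqP.
  by congr (- _); apply: DT_ev; rewrite e addnC.
rewrite ssum_sbind [evT _ _]/=.
rewrite (br_lin (erefl _) _ _ (elim_tree_wt sx) (mE _ sx) (IHs sx)) //.
apply: (eq_ssum_alls (elim_tree_wt sx)) => s' /eqP e; rewrite ssum_smap.
by rewrite (br_linr (erefl _) _ _ (elim_tree_wt tx) (mE _ tx) (IHt tx)) //; apply/mE/eqP.
Qed.
End Elimination.

Lemma sub_fctE (T : Type) (W : zmodType) (f g : T -> W) x : (f - g) x = f x - g x.
Proof. by []. Qed.

(** * The Lie ring of additive operators *)

Section OperatorLie.
Variable V : zmodType.
Implicit Types f g : V -> V.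

Definition opbr f g : V -> V := fun h => f (g h) - g (f h).

Lemma opbr_additive f g : additive_fun f -> additive_fun g -> additive_fun (opbr f g).
Proof. by move=> fB gB x y; rewrite /opbr !(fB, gB) !opprD !opprK addrACA. Qed.

Lemma jacobi_zmod (a b c d e f : V) :
  a - b - (c - d) = a - e - (f - d) + (e - c - (b - f)).
Proof.
rewrite !opprB [RHS]addrACA !addrA !subrK -!addrA; congr (_ + _).
by rewrite addrCA [RHS]addrCA [- b + _]addrC.
Qed.

Lemma ssum_fct (T : Type) (W : zmodType) I (u : seq (bool * I)) (F : I -> T -> W) h :
  ssum u F h = ssum u (fun i => F i h).
Proof. exact: (@ssumf _ _ (fun g : T -> W => g h)). Qed.

Lemma opbr_ssum I (l : seq (bool * I)) (F : I -> V -> V) g : additive_fun g ->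
  opbr (ssum l F) g = ssum l (fun t => opbr (F t) g).
Proof.
move=> gB; apply/funext => h; rewrite ssum_fct /opbr ssumB !ssum_fct.
by rewrite (ssumf _ _ gB).
Qed.

Lemma opbr_jacobi f g k : additive_fun f -> additive_fun g -> additive_fun k ->
  opbr f (opbr g k) = opbr (opbr f g) k + opbr g (opbr f k).
Proof.
move=> fB gB kB; apply/funext => h; rewrite addrfctE /opbr !(fB, gB, kB).
exact: jacobi_zmod.
Qed.

(** Every degree has the same component, and homogeneous means additive, so that the results on
    graded Lie rings apply to operators. *)
Definition opLie : gradedLie.
Proof.
apply: (@GradedLie (V -> V) (fun _ f => additive_fun f) opbr (fun=> (V -> V : zmodType))
    (fun _ f => f)).
- by move=> *; apply: opbr_additive.
- by move=> I l P F i j d f g _ _ gB _ _ ->; apply: opbr_ssum.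
- by move=> *; apply/funext => h; rewrite opprfctE /opbr opprB.
- by move=> *; apply/funext => h; rewrite /opbr subrr.
- by move=> *; apply: opbr_jacobi.
Defined.
End OperatorLie.

(** * Expansion of bracketings into associative words *)

Section Words.
Variable A : eqType.

Fixpoint words (t : tree A) : seq (bool * seq A) :=
  match t with
  | Leaf a => [:: (false, [:: a])]
  | Node s t => sbind (words s) (fun w => smap (cat w) (words t)) ++
                negs (sbind (words t) (fun w => smap (cat w) (words s)))
  end.

(* The signed sum [u] of bracketings vanishes in the free associative ring. *)
Definition assoc_zero (u : seq (bool * tree A)) :=
  forall w, ssum (sbind u words) (fun w' => (w' == w)%:R : int) = 0.

Lemma words_perm t : alls (perm_eq^~ (leaves t)) (words t).
Proof.
elim: t => [a|s IHs t IHt]; first by rewrite /alls /= perm_refl.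
rewrite /= alls_cat alls_negs; apply/andP; split.
  apply: alls_sbind IHs _ => w sw; rewrite alls_smap; apply: sub_alls IHt => v tv /=.
  exact: perm_cat.
apply: alls_sbind IHt _ => w sw; rewrite alls_smap; apply: sub_alls IHs => v tv /=.
by rewrite perm_catC; apply: perm_cat.
Qed.

(** If [p] can be read off from each word of a tree, then trees with and without [p] share no word
    and cannot cancel each other. *)
Lemma assoc_zero_filter u (p : pred (tree A)) (q : pred (seq A)) :
  (forall t, alls (fun w => q w == p t) (words t)) ->
  assoc_zero u -> assoc_zero [seq i <- u | p i.2].
Proof.
move=> pq H w; have := H w; rewrite !ssum_sbind.
set c := fun t => _; rewrite -(ssum_filter_all p).
have c0 t : p t != q w -> c t = 0.
  move=> ptw; rewrite /c -(ssum0 _ (words t)); apply: (eq_ssum_alls (pq t)) => v /eqP e.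
  by case: eqVneq => // ev; rewrite -e ev eqxx in ptw.
have [qw|qw] := boolP (q w).
  rewrite [X in _ + X](_ : _ = 0) ?addr0 //.
  rewrite -[RHS](ssum0 _ [seq i <- u | ~~ p i.2]).
  apply: (@eq_ssum_alls _ _ (fun t => ~~ p t)) => [|t pt]; first exact: filter_all.
  by apply: c0; rewrite (negPf pt) qw.
move=> _; rewrite -[RHS](ssum0 _ [seq i <- u | p i.2]).
apply: (@eq_ssum_alls _ _ p) => [|t pt]; first exact: filter_all.
by apply: c0; rewrite pt (negPf qw).
Qed.

Lemma evT_words (V : zmodType) (psi : A -> opLie V) t h :
    (forall a, additive_fun (psi a)) ->
  evT psi t h = ssum (words t) (foldr psi h).
Proof.
move=> psiB; elim: t h => [a|s IHs t IHt] h; first by rewrite ssum_cons ssum_nil addr0.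
have foldB w : additive_fun (foldr psi ^~ w).
  by move=> x y; elim: w => //= a w ->; rewrite psiB.
have cat_eq s' t' : (forall h', evT psi s' h' = ssum (words s') (foldr psi h')) ->
    (forall h', evT psi t' h' = ssum (words t') (foldr psi h')) ->
  evT psi s' (evT psi t' h) =
    ssum (words s') (fun w => ssum (smap (cat w) (words t')) (foldr psi h)).
  move=> -> e; rewrite e; apply: eq_ssum => w; rewrite ssum_smap [LHS](ssumf _ _ (foldB w)).
  by apply: eq_ssum => v /=; rewrite foldr_cat.
by rewrite /= /opbr ssum_cat ssum_negs !ssum_sbind -!cat_eq.
Qed.

(** The universal property of the free associative ring: any assignment of operators to letters
    factors through it. *)
Lemma assoc_zero_ev (V : zmodType) (psi : A -> opLie V) u h :
    (forall a, additive_fun (psi a)) -> assoc_zero u ->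
  ssum u (fun t => evT psi t h) = 0.
Proof.
move=> psiB u0; under eq_ssum do rewrite evT_words //.
by rewrite -ssum_sbind; apply: ssum_free.
Qed.

(** Left multiplication by the letter [a] on noncommutative power series, encoded by their
    coefficient functions. *)
Definition lmul (a : A) (h : seq A -> int) : seq A -> int :=
  fun w => if w is b :: w' then if b == a then h w' else 0 else 0.

Lemma lmulB a : additive_fun (lmul a).
Proof.
move=> g h; apply/funext => -[|b w]; rewrite sub_fctE /= ?subr0 //.
by case: eqP; rewrite ?subr0.
Qed.

Definition delta0 (w : seq A) : int := (w == [::])%:R.

Lemma foldr_lmul w v : foldr lmul delta0 w v = (w == v)%:R.
Proof.
elim: w v => [|a w IH] [|b v] //=; rewrite eqseq_cons [a == b]eq_sym.
by case: eqP => //= _; rewrite IH.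
Qed.

(** The left regular representation is faithful: applied to the series 1, which is [delta0], it
    returns the coefficients. *)
Lemma lmul_assoc_zero u :
  (forall v, ssum u (fun t => evT (lmul : A -> opLie (seq A -> int)) t delta0 v) = 0) ->
  assoc_zero u.
Proof.
move=> H w; rewrite ssum_sbind -[RHS](H w); apply: eq_ssum => t.
rewrite evT_words; last exact: lmulB.
by rewrite ssum_fct; apply: eq_ssum => v; rewrite foldr_lmul.
Qed.
End Words.

Section EliminationFree.
Variables (A : eqType) (x : A).
Local Notation B := (letter' x).

Fixpoint incr_coef (w : seq B) (h : seq B -> int) : int :=
  if w is (y, i) :: w' then
    (if i is j.+1 then h ((y, j) :: w') else 0) + incr_coef w' (fun v => h ((y, i) :: v))
  else 0.

(* In terms of coefficient functions, the derivation of the free ring on [B] that sends the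
   letter [(y, i)] to [(y, i.+1)]. *)
Definition deriv (h : seq B -> int) : seq B -> int := incr_coef^~ h.

Lemma derivB : additive_fun deriv.
Proof.
move=> g h; apply/funext => w; rewrite /deriv.
rewrite sub_fctE; elim: w g h => [|[y i] w IH] g h /=; first by rewrite subr0.
rewrite (IH (fun v => g ((y, i) :: v)) (fun v => h ((y, i) :: v))) opprD addrACA.
by case: i {IH}; rewrite ?subr0.
Qed.

Lemma deriv_if (b : bool) h w :
  deriv (fun v => if b then h v else 0) w = if b then deriv h w else 0.
Proof.
case: b => //; rewrite /deriv; elim: w {h} => [//|[y i] w IH] /=.
by rewrite IH; case: i; rewrite addr0.
Qed.

(** For a derivation $D$, the commutator of $D$ with left multiplication by $b$ is left
    multiplication by $D(b)$. *)
Lemma deriv_lmul y i : opbr deriv (lmul (y, i)) = lmul (y, i.+1).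
Proof.
apply/funext => h; apply/funext => -[|[z j] w] //=.
rewrite {1}/opbr sub_fctE /=.
rewrite deriv_if addrK; case: j => [|j] /=; first by case: eqP => // -[].
by rewrite !xpair_eqE eqSS.
Qed.

(* The free ring on [A] acts on that on [B], [x] as the derivation and [y != x] as left
   multiplication by [(y, 0)]; then [ad(x)^i y] acts as left multiplication by [(y, i)], so
   that a relation between letters of [A] yields one between letters of [B]. *)
Definition elim_act (a : A) : (seq B -> int) -> (seq B -> int) :=
  if insub a is Some y then lmul (y, 0%N) else deriv.

Lemma elim_actB a : additive_fun (elim_act a).
Proof. by rewrite /elim_act; case: insub => [y|]; [apply: lmulB | apply: derivB]. Qed.

Lemma phi'_elim_act b : phi' (L := opLie _) elim_act b = lmul b.
Proof.
case: b => y i; rewrite /phi' /=; elim: i => [|i IH]; first by rewrite /elim_act /= valK.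
by rewrite iterS IH /= -deriv_lmul {1}/elim_act insubF ?eqxx.
Qed.

Lemma assoc_zero_elim u : alls (fun t => ~~ is_x x t) u -> assoc_zero u ->
  assoc_zero (sbind u (elim_tree x)).
Proof.
move=> ux u0; apply: lmul_assoc_zero => v; rewrite ssum_sbind.
rewrite -[RHS]/((0 : seq B -> int) v) -(assoc_zero_ev (@delta0 _) elim_actB u0) ssum_fct.
apply: (eq_ssum_alls ux) => t tx.
have := elim_tree_ev (wt := fun=> 0%N) (L := opLie (seq B -> int)) elim_actB tx.
have -> : phi' (L := opLie (seq B -> int)) elim_act = (@lmul _ : B -> opLie (seq B -> int)).
  by apply/funext => b; rewrite phi'_elim_act.
by rewrite /= => ->; rewrite !ssum_fct.
Qed.
End EliminationFree.

(** Outer induction on the bound [r] for the number of leaves, inner induction on a list of the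
    letters that occur. The alphabet and its weights are quantified inside because elimination
    changes them. *)
Theorem free_lie_injective (r : nat) : forall (A : eqType) (L : gradedLie) (wt : A -> nat)
    (phi : A -> L) (k : nat) (u : seq (bool * tree A)),
  (forall a, homog (wt a) (phi a)) ->
  alls (fun t => wtT wt t == k) u -> alls (fun t => size (leaves t) <= r)%N u ->
  assoc_zero u -> ssum u (fun t => pr k (evT phi t)) = 0.
Proof.
have leaves_gt0 A (t : tree A) : (0 < size (leaves t))%N.
  by elim: t => //= s IHs t _; rewrite size_cat ltn_addr.
elim: r => [|r IHr] A L wt phi k u phiM uk ur u0.
  case: u ur {u0 uk} => [_|p u /andP[]]; first by rewrite ssum_nil.
  by rewrite leqNgt leaves_gt0.
have [ls uls] : exists ls : seq A, alls (fun t => all (fun a => a \in ls) (leaves t)) u.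
  elim: u {uk ur u0} => [|p u [ls uls]]; first by exists [::].
  exists (leaves p.2 ++ ls); rewrite /alls /=; apply/andP; split.
    by apply/allP => a a_p; rewrite mem_cat a_p.
  apply: (sub_alls (R := fun t => all (fun a => a \in leaves p.2 ++ ls) (leaves t)) _ uls).
  move=> t /allP tls; apply/allP => a /tls.
  by rewrite mem_cat => ->; rewrite orbT.
elim: ls u uk ur u0 uls => [|x ls IHls] u uk ur u0 uls.
  case: u uls {uk ur u0} => [_|p u /andP[]]; first by rewrite ssum_nil.
  by have := leaves_gt0 _ p.2; case: (leaves _).
have filtP (P Q : pred (tree A)) v : alls P v -> alls P [seq p <- v | Q p.2].
  by rewrite /alls all_filter; apply: sub_all => p /= ->; rewrite implybT.
have filtQ (Q : pred (tree A)) v : alls Q [seq p <- v | Q p.2] by apply: filter_all.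
have wordsx p t : perm_eq p (leaves t) -> (x \in p) = (x \in leaves t) by move/perm_mem->.
(* All words of a tree have the letters of its leaves, so the trees with [x] and those without
   vanish separately; the latter use fewer letters. *)
rewrite -(ssum_filter_all (fun t => x \in leaves t)).
rewrite [X in _ + X]IHls ?addr0; last first.
- have : alls (fun t => x \notin leaves t) [seq p <- u | x \notin leaves p.2] by apply: filtQ.
  move/(alls_and (filtP _ (fun t => x \notin leaves t) _ uls)).
  apply: sub_alls => t /andP[/allP pls xp]; apply/allP => a a_p.
  by have := pls _ a_p; rewrite !inE => /orP[/eqP ax|//]; rewrite -ax a_p in xp.
- apply: (assoc_zero_filter (q := fun w => x \notin w) (p := fun t => x \notin leaves t)) u0.
  move=> t; apply: sub_alls (words_perm t) => w wt_; by rewrite (wordsx _ t).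
- exact: (filtP _ (fun t => x \notin leaves t)).
- exact: (filtP _ (fun t => x \notin leaves t)).
have {}u0 : assoc_zero [seq p <- u | x \in leaves p.2].
  apply: (assoc_zero_filter (q := fun w => x \in w) (p := fun t => x \in leaves t)) u0.
  by move=> t; apply: sub_alls (words_perm t) => w wt_; rewrite (wordsx _ t).
have {uk} := filtP _ (fun t => x \in leaves t) _ uk.
have {ur} := filtP _ (fun t => x \in leaves t) _ ur.
have := filtQ (fun t => x \in leaves t) u.
move: [seq p <- u | _] u0 => {IHls uls}u u0 ux ur uk.
have is_xP t : alls (fun w => (w == [:: x]) == is_x x t) (words t).
  case: t => [a|s t]; first by rewrite /alls /= eqseq_cons eqxx !andbT.
  apply: sub_alls (words_perm _) => w /perm_size /=; rewrite size_cat.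
  have := leaves_gt0 _ s; have := leaves_gt0 _ t; case: w => [|b [|c w]] //=; last first.
    by rewrite eqseq_cons andbF.
  lia.
(* Only the leaf [x] expands into the word [[:: x]], so the signed count of such leaves is a
   coefficient of the expansion, hence zero. *)
rewrite -(ssum_filter_all (is_x x)).
rewrite [X in X + _](_ : _ = 0) ?add0r; last first.
  have {}u0 := assoc_zero_filter is_xP u0.
  move: [seq p <- u | _] u0 (filtQ (is_x x) u) => v v0 vx.
  have := v0 [:: x]; rewrite ssum_sbind.
  rewrite (eq_ssum_alls (V := int) (F' := fun=> 1) vx) => [v1|]; last first.
    by case=> //= a /eqP ->; rewrite ssum_cons ssum_nil addr0 /= eqxx.
  rewrite (eq_ssum_alls (F' := fun=> pr k (phi x) *~ 1) vx) => [|[] //= a /eqP-> //].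
  rewrite -[LHS](ssumf _ _ (f := fun c => pr k (phi x) *~ c)) ?v1 // => c d.
  by rewrite mulrzBr.
have nis_xP t : alls (fun w => (w != [:: x]) == ~~ is_x x t) (words t).
  by apply: sub_alls (is_xP t) => w /eqP ->.
have {u0} := assoc_zero_filter nis_xP u0.
move: (filtQ (fun t => ~~ is_x x t) u) (filtP _ (fun t => ~~ is_x x t) _ uk).
move: (filtP _ (fun t => ~~ is_x x t) _ ur) (filtP _ (fun t => ~~ is_x x t) _ ux).
move: [seq p <- u | _] => {ux ur uk}u ux ur nx uk u0.
rewrite (eq_ssum_alls (P := fun t => (wtT wt t == k) && ~~ is_x x t)
  (F' := fun t => ssum (elim_tree x t) (fun t' => pr k (evT (phi' phi) t')))); last first.
- by move=> t /andP[/eqP <- tx]; apply: elim_tree_ev.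
- exact: alls_and.
rewrite -ssum_sbind; apply: (IHr _ _ (wt' wt)).
- exact: phi'_mem.
- apply: (alls_sbind (P := fun t => (wtT wt t == k) && ~~ is_x x t)).
    exact: alls_and.
  by move=> t /andP[/eqP <- tx]; apply: elim_tree_wt.
(* Every remaining tree contains [x], so elimination removes at least one leaf and the bound drops
   to [r]. *)
- apply: (alls_sbind (P := fun t => [&& size (leaves t) <= r.+1, x \in leaves t & ~~ is_x x t])%N).
    by apply: alls_and => //; apply: alls_and.
  move=> t /and3P[tr xt tx]; apply: sub_alls (elim_tree_size tx) => t' /eqP e.
  rewrite -has_pred1 has_count in xt.
  by rewrite -ltnS; apply: leq_trans tr; rewrite -e -addn1 leq_add2l.
- exact: assoc_zero_elim.
Qed.

(** * The graded Lie ring of the lower central series *)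

Section AbelianSubquotient.
Local Open Scope group_scope.

Record subquotient (G : groupType) := Subquotient {
  sq_num : G -> Prop;
  sq_den : G -> Prop;
  sq_numP : subgrp sq_num;
  sq_denP : subgrp sq_den;
  sq_sub : forall x, sq_den x -> sq_num x;
  sq_comm : forall x y, sq_num x -> sq_num y -> sq_den (cmg x y) }.

Variables (G : groupType) (d : subquotient G).
Local Notation A := (sq_num d).
Local Notation B := (sq_den d).

(** A chosen representative of the coset of [x], which realises the quotient as a subtype of [G]. *)
Definition sq_rep (x : G) : G := choose (fun y => `[< B (x * y^-1) >]) x.

Let B1 : B 1. Proof. by case: (sq_denP d). Qed.
Let BM x y : B x -> B y -> B (x * y). Proof. by case: (sq_denP d) => _ + _; apply. Qed.
Let BV x : B x -> B x^-1. Proof. by case: (sq_denP d) => _ _; apply. Qed.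
Let A1 : A 1. Proof. by case: (sq_numP d). Qed.
Let AM x y : A x -> A y -> A (x * y). Proof. by case: (sq_numP d) => _ + _; apply. Qed.
Let AV x : A x -> A x^-1. Proof. by case: (sq_numP d) => _ _; apply. Qed.

Lemma sq_repP x : B (x * (sq_rep x)^-1).
Proof.
apply/asboolP; apply: (@chooseP _ (fun y => `[< B (x * y^-1) >])).
by apply/asboolP; rewrite mulgV.
Qed.

Lemma sq_rep_eq x y : B (x * y^-1) -> sq_rep x = sq_rep y.
Proof.
move=> Bxy; rewrite /sq_rep.
rewrite (@eq_choose _ _ (fun z => `[< B (y * z^-1) >])); last first.
  move=> z; apply/asboolP/asboolP => Bz.
    by move: (BM (BV Bxy) Bz); rewrite !gnorm.
  by move: (BM Bxy Bz); rewrite !gnorm.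
apply: choose_id; apply/asboolP; last by rewrite mulgV.
by move: (BV Bxy); rewrite !gnorm.
Qed.

Lemma sq_rep_num x : A x -> A (sq_rep x).
Proof.
move=> Ax; have := AM (AV (sq_sub (sq_repP x))) Ax; by rewrite !gnorm.
Qed.

Lemma sq_rep_id x : sq_rep (sq_rep x) = sq_rep x.
Proof. apply: sq_rep_eq; by move: (BV (sq_repP x)); rewrite !gnorm. Qed.

Definition sq_type := {x : G | `[< A x >] && (sq_rep x == x)}.
HB.instance Definition _ := Choice.on sq_type.

Lemma sq_type_proof x : A x -> `[< A (sq_rep x) >] && (sq_rep (sq_rep x) == sq_rep x).
Proof. by move=> Ax; rewrite sq_rep_id eqxx andbT; apply/asboolP/sq_rep_num. Qed.

(** The projection is made total on [G]: outside the numerator it takes the default value, the class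
    of 1. *)
Definition sq_pr (x : G) : sq_type :=
  insubd (Sub (sq_rep 1) (sq_type_proof A1) : sq_type) (sq_rep x).

Lemma val_sq_pr x : A x -> val (sq_pr x) = sq_rep x.
Proof. by move=> Ax; rewrite val_insubd sq_type_proof. Qed.

Lemma sq_val_num (q : sq_type) : A (val q).
Proof. by case/andP: (valP q) => /asboolP. Qed.

Lemma sq_valK (q : sq_type) : sq_pr (val q) = q.
Proof.
by apply: val_inj; rewrite (val_sq_pr (sq_val_num q)); case/andP: (valP q) => _ /eqP.
Qed.

Lemma sq_prP x y : A x -> A y -> sq_pr x = sq_pr y <-> B (x * y^-1).
Proof.
move=> Ax Ay; split=> [e|Bxy].
  have := congr1 val e; rewrite !val_sq_pr // => exy.
  by have := BM (sq_repP x) (BV (sq_repP y)); rewrite exy !gnorm.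
by apply: val_inj; rewrite !val_sq_pr //; apply: sq_rep_eq.
Qed.

Definition sq_add (p q : sq_type) := sq_pr (val p * val q).
Definition sq_opp (p : sq_type) := sq_pr (val p)^-1.

Lemma sq_conj a x : A a -> B x -> B (a * x * a^-1).
Proof.
by move=> Aa Bx; move: (BM (sq_comm Aa (sq_sub Bx)) Bx); rewrite /cmg !gnorm.
Qed.

Lemma sq_prM x y : A x -> A y -> sq_pr (x * y) = sq_add (sq_pr x) (sq_pr y).
Proof.
move=> Ax Ay; apply/sq_prP; first exact: AM.
  by apply: AM; apply: sq_val_num.
rewrite !val_sq_pr //.
have := BM (sq_conj Ax (sq_repP y)) (sq_repP x); by rewrite !gnorm.
Qed.

Lemma sq_prV x : A x -> sq_pr x^-1 = sq_opp (sq_pr x).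
Proof.
move=> Ax; apply/sq_prP; [exact: AV | by apply/AV/sq_val_num |].
rewrite val_sq_pr //; have := sq_conj (AV Ax) (BV (sq_repP x)); by rewrite !gnorm.
Qed.

Lemma sq_addA : associative sq_add.
Proof.
move=> p q r; rewrite -{1}[p]sq_valK -{2}[r]sq_valK -!sq_prM ?mulgA //;
  by do ?[apply: AM]; apply: sq_val_num.
Qed.

Lemma sq_addC : commutative sq_add.
Proof.
move=> p q; apply/sq_prP; try by apply: AM; apply: sq_val_num.
by have := sq_comm (sq_val_num p) (sq_val_num q); rewrite /cmg !gnorm.
Qed.

Lemma sq_add0 : left_id (sq_pr 1) sq_add.
Proof.
move=> p; rewrite -{2}[p]sq_valK -[p in LHS]sq_valK -sq_prM ?mul1g //; exact: sq_val_num.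
Qed.

Lemma sq_addN : left_inverse (sq_pr 1) sq_opp sq_add.
Proof.
move=> p; rewrite -[p]sq_valK -sq_prV; last exact: sq_val_num.
by rewrite -sq_prM ?mulVg //; [apply: AV|]; apply: sq_val_num.
Qed.

HB.instance Definition _ := GRing.isZmodule.Build sq_type sq_addA sq_addC sq_add0 sq_addN.

Lemma sq_prD x y : A x -> A y -> sq_pr (x * y) = (sq_pr x + sq_pr y)%R.
Proof. exact: sq_prM. Qed.
Lemma sq_prN x : A x -> sq_pr x^-1 = (- sq_pr x)%R.
Proof. exact: sq_prV. Qed.
Lemma sq_pr1 : sq_pr 1 = 0%R. Proof. by []. Qed.
End AbelianSubquotient.

(** * The bracket induced by commutators *)

Section LcsLie.
Local Open Scope group_scope.
Variable G : groupType.
Local Notation L := (lcs_aux (gops G) (fun=> True)).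

Lemma lcs_quo_comm k (x y : G) : L k x -> L k y -> L k.+1 (cmg x y).
Proof. by move=> _; apply: L_cmg0. Qed.

Definition lcs_quo k : subquotient G :=
  Subquotient (L_subgrp G k) (L_subgrp G k.+1) (@LS G k) (@lcs_quo_comm k).

Local Notation pr k := (@sq_pr G (lcs_quo k)).

(** A lift of [ssum] to the group: its class is the signed sum of the classes of the factors. *)
Definition prodl I (l : seq (bool * I)) (F : I -> G) : G :=
  foldr (fun p acc => (if p.1 then (F p.2)^-1 else F p.2) * acc) 1 l.

Section Prodl.
Variables (I : Type) (P : pred I) (F : I -> G) (i : nat).
Hypothesis FL : forall t, P t -> L i (F t).

Lemma prodl_mem l : alls P l -> L i (prodl l F).
Proof.
elim: l => [_|p l IH /= /andP[Pp /IH Ll]]; first exact: L1.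
by apply: LM Ll; case: p.1; [apply: LV|]; apply: FL.
Qed.

Lemma pr_prodl l : alls P l -> pr i (prodl l F) = ssum l (fun t => pr i (F t)).
Proof.
elim: l => [_|p l IH /= /andP[/FL Fp Pl]]; first by rewrite ssum_nil.
rewrite ssum_cons sq_prD; last exact: prodl_mem.
  by rewrite IH //; case: p.1 => //=; rewrite sq_prN.
by case: p.1 => //; apply: LV.
Qed.

Lemma pr_cmg_prodl l j y : alls P l -> L j y ->
  pr (i + j).+1 (cmg (prodl l F) y) = ssum l (fun t => pr (i + j).+1 (cmg (F t) y)).
Proof.
move=> + Ly; elim: l => [_|p l IH /= /andP[/FL Fp Pl]].
  by rewrite ssum_nil /cmg !gnorm.
have Lp : L i (if p.1 then (F p.2)^-1 else F p.2) by case: p.1 => //; apply: LV.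
have Ll := prodl_mem Pl.
rewrite ssum_cons -IH //.
rewrite [LHS](_ : _ = pr (i + j).+1
    (cmg (if p.1 then (F p.2)^-1 else F p.2) y * cmg (prodl l F) y)).
  rewrite sq_prD; try exact: L_cmg.
  congr (_ + _)%R; case: p.1 {Lp} => //=; rewrite -sq_prN; last exact: L_cmg.
  apply/sq_prP; [exact/L_cmg/Ly/LV | exact/LV/L_cmg | exact: cmgVl_eqm].
apply/sq_prP; [exact/L_cmg/Ly/LM | by apply: LM; apply: L_cmg | exact: cmgMl_eqm].
Qed.
End Prodl.

Lemma lcs_br_lin I (l : seq (bool * I)) (P : pred I) (F : I -> G) i j d (x y : G) :
    d = (i + j).+1 -> L i x -> L j y ->
    alls P l -> (forall t, P t -> L i (F t)) -> pr i x = ssum l (fun t => pr i (F t)) ->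
  pr d (cmg x y) = ssum l (fun t => pr d (cmg (F t) y)).
Proof.
move=> -> Lx Ly Pl FL; rewrite -(pr_prodl FL Pl) -(pr_cmg_prodl FL Pl Ly).
have Ll := prodl_mem FL Pl.
move=> /(sq_prP (d := lcs_quo i) Lx Ll) e; apply/sq_prP; try exact: L_cmg.
exact: (@cmg_eqml _ i.+1 j).
Qed.

Definition lcsLie : gradedLie.
Proof.
apply: (@GradedLie G (fun k => L k) (@cmg G) (fun k => sq_type (lcs_quo k))
    (fun k => pr k)).
- exact: L_cmg.
- exact: lcs_br_lin.
- by move=> i j d x y -> Lx Ly; rewrite -cmg_inv sq_prN // addnC; apply: L_cmg.
- by move=> i x Lx; rewrite /cmg !gnorm.
- move=> i j l d x y z -> Lx Ly Lz; rewrite -sq_prD.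
  + apply/sq_prP.
    * by have := L_cmg Lx (L_cmg Ly Lz); congr (L _ _); lia.
    * apply: LM; [have := L_cmg (L_cmg Lx Ly) Lz | have := L_cmg Ly (L_cmg Lx Lz)];
        congr (L _ _); lia.
    * have := cmg_jacobi_eqm Lx Ly Lz; congr (L _ _); lia.
  + have := L_cmg (L_cmg Lx Ly) Lz; congr (L _ _); lia.
  + have := L_cmg Ly (L_cmg Lx Lz); congr (L _ _); lia.
Defined.

Section Span.
Variables (A : eqType) (g : A -> G).
Hypothesis g_gen : forall P : G -> Prop, subgrp P -> (forall a, P (g a)) -> forall x, P x.

Let span k x := exists u : seq (bool * tree A),
  alls (fun t => wtT (fun=> 0%N) t == k) u /\
  pr k x = ssum u (fun t => pr k (evT (g : A -> lcsLie) t)).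

Let evL k t : wtT (fun=> 0%N) t == k -> L k (evT (g : A -> lcsLie) t).
Proof. by move/eqP<-; apply: (@mem_evT lcsLie A (fun=> 0%N) g (fun=> I) t). Qed.

(** The graded Lie ring is generated in degree 0: expanding both entries of a generator [cmg a c] of
    the next term by bilinearity gives bracketings of the [g a]. *)
Lemma lcs_span k x : L k x -> span k x.
Proof.
have spanM l y z : L l y /\ span l y -> L l z /\ span l z -> L l (y * z) /\ span l (y * z).
  move=> [Ly [u [uP ey]]] [Lz [v [vP ez]]]; split; first exact: LM.
  exists (u ++ v); split; first by rewrite alls_cat uP vP.
  by rewrite sq_prD // ssum_cat ey ez.
have spanS l : subgrp (fun y => L l y /\ span l y).
  split=> [||y [Ly [u [uP e]]]]; last 1 first.
  - split; first exact: LV.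
    by exists (negs u); split; [rewrite alls_negs | rewrite sq_prN // ssum_negs e].
  - by split; [apply: L1 | exists [::]; split; rewrite ?ssum_nil].
  - exact: spanM.
have span0 y : span 0 y.
  suff [] : L 0 y /\ span 0 y by [].
  move: y; apply: (@g_gen (fun y => L 0 y /\ span 0 y)) => // a.
  split=> //; exists [:: (false, Leaf a)].
  by split=> //; rewrite ssum_cons ssum_nil addr0.
elim: k x => [|k IH] x Lx; first exact: span0.
suff [] : L k.+1 x /\ span k.+1 x by [].
move: x Lx; apply: (@gen_min _ _ (fun y => L k.+1 y /\ span k.+1 y)) => //.
move=> _ /comm_setE[a [c [_ Lc ->]]]; split; first exact: L_cmg0.
have [u [uP eu]] := span0 a.
have [v [vP ev]] := IH _ Lc.
exists (sbind u (fun s => smap (Node s) v)); split.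
  apply: alls_sbind uP _ => s /eqP es; rewrite alls_smap.
  by apply: sub_alls vP => t /eqP /= ->; rewrite es.
rewrite ssum_sbind (lcs_br_lin (i := 0) (j := k) (d := k.+1) _ _ _ uP (@evL 0%N) eu) //.
apply: (eq_ssum_alls uP) => s /evL Ls; rewrite ssum_smap.
exact: (br_linr (L := lcsLie) (i := 0) (j := k) _ Ls Lc vP (@evL k) ev).
Qed.
End Span.
End LcsLie.

(** * Free groups and the Magnus expansion *)

Section FreeGroup.
Variable n : nat.
Implicit Types (a b : letter n) (u v w : seq (letter n)).

Lemma linvK : involutive (@linv n).
Proof. by case=> i b; rewrite /linv /= negbK. Qed.

Section WordAction.
Variables (T : Type) (act : letter n -> T -> T).
Hypothesis actK : forall a, cancel (act (linv a)) (act a).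

Lemma foldr_push a w t : foldr act t (push a w) = act a (foldr act t w).
Proof. case: w => [|b w] //=; case: eqP => //= ->. exact/esym/actK. Qed.

Lemma foldr_reduce w t : foldr act t (reduce w) = foldr act t w.
Proof. by elim: w => //= a w IH; rewrite foldr_push IH. Qed.

Lemma foldr_linv w t : foldr act (foldr act t w) (rev (map (@linv n) w)) = t.
Proof.
elim: w t => //= a w IH t; rewrite rev_cons -cats1 foldr_cat /=.
by rewrite -[a in act a (foldr _ _ _)]linvK (actK (linv a)) IH.
Qed.
End WordAction.

Lemma reduce_id w : reduced w -> reduce w = w.
Proof.
elim: w => //= a w IH aw; rewrite IH; last exact: reduced_tail aw.
by case: w aw {IH} => //= b w /andP[/negPf-> _].
Qed.

Lemma pushK a w : reduced w -> push a (push (linv a) w) = w.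
Proof.
case: w => [|b w] /=; first by rewrite eqxx.
rewrite linvK; case: eqP => [-> |_]; last by rewrite /= eqxx.
by case: w => //= c w /andP[/negPf-> _].
Qed.

(** Van der Waerden's trick: letters act on reduced words by permutations, and multiplication is
    iterated action, which makes it associative. *)
Definition fg_act a (x : FG n) : FG n := exist _ (push a (val x)) (push_reduced a (valP x)).

Lemma fg_actK a : cancel (fg_act (linv a)) (fg_act a).
Proof. by move=> x; apply: val_inj; rewrite /= pushK //; apply: valP. Qed.

Lemma fg_mulE (x y : FG n) : fg_mul x y = foldr fg_act y (val x).
Proof.
apply: val_inj; rewrite /= /reduce foldr_cat -/(reduce _) reduce_id; last exact: valP.
by elim: (val x) => //= a w ->.
Qed.

Lemma fg_mulA : associative (@fg_mul n).
Proof.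
move=> x y z; rewrite [LHS]fg_mulE [RHS]fg_mulE [val (fg_mul _ _)]/=.
by rewrite (foldr_reduce fg_actK) foldr_cat fg_mulE.
Qed.

Lemma fg_mul1 : left_id (fg_one n) (@fg_mul n).
Proof. by move=> x; rewrite fg_mulE. Qed.

Lemma fg_mul1r : right_id (fg_one n) (@fg_mul n).
Proof. by move=> x; apply: val_inj; rewrite /= cats0 reduce_id //; apply: valP. Qed.

Lemma fg_mulV : left_inverse (fg_one n) (@fg_inv n) (@fg_mul n).
Proof.
move=> x; rewrite fg_mulE /= (foldr_reduce fg_actK) -{1}[x]fg_mul1r fg_mulE.
exact: foldr_linv fg_actK _ _.
Qed.

Lemma fg_mulVr : right_inverse (fg_one n) (@fg_inv n) (@fg_mul n).
Proof.
move=> x; rewrite -[fg_mul x _]fg_mul1 -{1}(fg_mulV (fg_inv x)) -fg_mulA.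
by rewrite [fg_mul (fg_inv x) _]fg_mulA fg_mulV fg_mul1 fg_mulV.
Qed.

HB.instance Definition _ := Choice.copy (FG n) {w : seq (letter n) | reduced w}.
HB.instance Definition _ := isGroup.Build (FG n) fg_mulA fg_mul1 fg_mul1r fg_mulV fg_mulVr.

Local Open Scope group_scope.

Definition letter_val (G : groupType) (v : 'I_n -> G) (a : letter n) : G :=
  if a.2 then (v a.1)^-1 else v a.1.

Lemma letter_valK (G : groupType) (v : 'I_n -> G) a :
  cancel (fun g => letter_val v (linv a) * g) (fun g => letter_val v a * g).
Proof. by move=> g; case: a => i [] /=; rewrite /letter_val /= ?mulKg ?mulVKg. Qed.

Definition fg_ext (G : groupType) (v : 'I_n -> G) (x : FG n) : G :=
  foldr (fun a g => letter_val v a * g) 1 (val x).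

Lemma fg_extM (G : groupType) (v : 'I_n -> G) (x y : FG n) :
  fg_ext v (x * y) = fg_ext v x * fg_ext v y.
Proof.
rewrite /fg_ext /= (foldr_reduce (@letter_valK _ v)) foldr_cat.
by elim: (val x) => [|a w IH] /=; rewrite ?mul1g // -mulgA -IH.
Qed.

Lemma fg_ext_x (G : groupType) (v : 'I_n -> G) i : fg_ext v (fg_x i) = v i.
Proof. by rewrite /fg_ext /= /letter_val /= mulg1. Qed.

Lemma fg_actE a x : fg_act a x = letter_val (@fg_x n) a * x.
Proof.
have E i y : fg_act (i, false) y = fg_x i * y by rewrite [RHS]fg_mulE.
case: a => i [] /=; last exact: E.
rewrite /letter_val /=; apply: (mulgI (fg_x i)); rewrite mulVKg -E.
exact: (fg_actK (i, false)).
Qed.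

Lemma fg_generated (P : FG n -> Prop) :
  subgrp P -> (forall i, P (fg_x i)) -> forall x, P x.
Proof.
move=> [P1 PM PV] Px x; rewrite -[x]fg_mul1r fg_mulE.
elim: (val x) => //= a w IH; rewrite fg_actE; apply: PM => //.
by rewrite /letter_val; case: a.2; [apply: PV|]; apply: Px.
Qed.

Lemma fg_hom_ext (G : groupType) (f g : FG n -> G) :
    (forall x y, f (x * y) = f x * f y) -> (forall x y, g (x * y) = g x * g y) ->
  (forall i, f (fg_x i) = g (fg_x i)) -> f =1 g.
Proof.
move=> fM gM; have [f1 fV] := morph_one_inv fM; have [g1 gV] := morph_one_inv gM.
apply: fg_generated; split=> [|x y ex ey|x ex].
- by rewrite f1 g1.
- by rewrite fM gM ex ey.
- by rewrite fV gV ex.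
Qed.
End FreeGroup.

(** * The Magnus expansion and the lower central series *)

Section Magnus.
Variable n : nat.
Local Notation V := (seq 'I_n -> int).
Local Notation L := (lcs_aux (gops (FG n)) (fun=> True)).
Implicit Types (g h : FG n) (f : V) (S T : V -> V).

(* (1 + X_i)^-1 f *)
Fixpoint inv1D i f (w : seq 'I_n) : int :=
  f w - (if w is b :: w' then if b == i then inv1D i f w' else 0 else 0).

Definition magnus_letter (a : letter n) f : V :=
  if a.2 then inv1D a.1 f else f + lmul a.1 f.

Lemma magnus_letterK a : cancel (magnus_letter (linv a)) (magnus_letter a).
Proof.
case: a => i [] f; apply/funext; elim=> [|b w IH]; rewrite /magnus_letter /= ?addrfctE /=.
- by rewrite addr0 subr0.
- move: IH; rewrite /magnus_letter /= => ->.
  by rewrite addrK.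
- by rewrite subr0 addr0.
- by rewrite subrK.
Qed.

(** Left multiplication by the Magnus expansion of [g], where $x_i \mapsto 1 + X_i$; the expansion
    itself is [magnus g (@delta0 _)]. *)
Definition magnus g f : V := foldr magnus_letter f (val g).

Lemma magnusM g h f : magnus (g * h)%g f = magnus g (magnus h f).
Proof. by rewrite /magnus /= (foldr_reduce magnus_letterK) foldr_cat. Qed.

Lemma magnus1 f : magnus 1%g f = f. Proof. by []. Qed.

Lemma magnus_x i f : magnus (fg_x i) f = f + lmul i f. Proof. by []. Qed.

Lemma inv1DB i : additive_fun (inv1D i).
Proof.
move=> f f'; apply/funext; elim=> [|b w IH]; rewrite sub_fctE /= ?subr0 //.
rewrite IH sub_fctE; case: eqP => _; last by rewrite !subr0.
by rewrite sub_fctE !opprD !opprK addrACA.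
Qed.

Lemma magnusB g : additive_fun (magnus g).
Proof.
rewrite /magnus; elim: (val g) => //= a w IH f f'; rewrite IH /magnus_letter.
case: a.2; first exact: inv1DB.
by rewrite lmulB opprD addrACA.
Qed.

Definition vanishes m f := forall w, (size w < m)%N -> f w = 0.
Definition degree_ge r T := forall m f, vanishes m f -> vanishes (r + m) (T f).

Lemma vanishesD m f f' : vanishes m f -> vanishes m f' -> vanishes m (f + f').
Proof. by move=> vf vf' w wm; rewrite addrfctE vf // vf' // addr0. Qed.
Lemma vanishesN m f : vanishes m f -> vanishes m (- f).
Proof. by move=> vf w wm; rewrite opprfctE vf // oppr0. Qed.
Lemma vanishesB m f f' : vanishes m f -> vanishes m f' -> vanishes m (f - f').
Proof. by move=> vf vf'; apply: vanishesD => //; apply: vanishesN. Qed.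
Lemma vanishesW m m' f : (m' <= m)%N -> vanishes m f -> vanishes m' f.
Proof. by move=> le vf w wm; apply: vf; apply: leq_trans le. Qed.

Lemma degree_geW r r' T : (r' <= r)%N -> degree_ge r T -> degree_ge r' T.
Proof. by move=> le dT m f /dT; apply: vanishesW; rewrite leq_add2r. Qed.

Lemma lmul_degree i : degree_ge 1 (lmul i).
Proof.
by move=> m f vf [|b w] //=; case: eqP => // _ wm; apply: vf.
Qed.

Definition magnus_m1 g f : V := magnus g f - f.

Lemma magnusE g f : magnus g f = magnus_m1 g f + f. Proof. by rewrite subrK. Qed.

Lemma magnus_m1M g h f : magnus_m1 (g * h)%g f = magnus_m1 g (magnus h f) + magnus_m1 h f.
Proof. by rewrite /magnus_m1 magnusM addrA subrK. Qed.

Lemma magnus_m1B g : additive_fun (magnus_m1 g).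
Proof. by move=> f f'; rewrite /magnus_m1 magnusB !opprD !opprK addrACA. Qed.

Lemma magnus_m1D g f f' : magnus_m1 g (f + f') = magnus_m1 g f + magnus_m1 g f'.
Proof. exact: additive_funD (@magnus_m1B g) _ _. Qed.

Lemma magnus_degree0 g : degree_ge 0 (magnus g).
Proof.
move=> m f vf; rewrite /magnus; elim: (val g) => //= a w; move: (foldr _ _ _) => {vf}f vf.
rewrite /magnus_letter; case: a.2; last first.
  by apply: vanishesD => //; apply: vanishesW (@lmul_degree a.1 _ _ vf); rewrite addnC.
elim=> [|b v IH] vm /=; first by rewrite subr0; apply: vf.
rewrite vf // sub0r; case: eqP => _; last by rewrite oppr0.
by rewrite IH ?oppr0 //; apply: ltnW.
Qed.

Lemma magnus_m1_subgrp r : subgrp (fun g => degree_ge r (magnus_m1 g)).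
Proof.
split=> [m f vf|g h gr hr m f vf|g gr m f vf].
- by rewrite /magnus_m1 magnus1 subrr.
- rewrite magnus_m1M; apply: vanishesD; last exact: hr.
  by apply: gr; apply: magnus_degree0.
- have -> : magnus_m1 g^-1%g f = - magnus g^-1%g (magnus_m1 g f).
    by rewrite [in RHS]/magnus_m1 magnusB -magnusM mulVg magnus1 opprB.
  by apply: vanishesN; apply: magnus_degree0; apply: gr.
Qed.

Lemma magnus_degree1 g : degree_ge 1 (magnus_m1 g).
Proof.
move: g; apply: fg_generated (magnus_m1_subgrp 1) _ => i m f vf.
by rewrite /magnus_m1 magnus_x addrAC subrr add0r; apply: lmul_degree.
Qed.

(** In the power series ring, $[g,h] - 1 = (gh - hg)g^{-1}h^{-1}$, and $gh - hg$ is unchanged when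
    $g$ and $h$ are replaced by $g-1$ and $h-1$. *)
Lemma magnus_m1_cmg g h f :
  magnus_m1 (cmg g h) f = opbr (magnus_m1 g) (magnus_m1 h) (magnus (g^-1 * h^-1)%g f).
Proof.
set f' := magnus _ f; have ef : f = magnus (h * g)%g f'.
  by rewrite -magnusM !gnorm magnus1.
rewrite /magnus_m1 [in LHS]ef -magnusM.
have -> : (cmg g h * (h * g) = g * h)%g by rewrite /cmg !gnorm.
rewrite /opbr !magnusB !magnusM.
by apply/funext => w; rewrite !sub_fctE; lia.
Qed.

(* [T] is the leading part, of degree [k.+1], of the Magnus expansion of [g]. *)
Definition symbol k g T := [/\ additive_fun T, degree_ge k.+1 T &
  degree_ge k.+2 (fun f => magnus_m1 g f - T f)].

Lemma degree_ge_comp r s S T : degree_ge r S -> degree_ge s T ->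
  degree_ge (r + s) (fun f => S (T f)).
Proof. by move=> dS dT m f /dT /dS; rewrite addnA. Qed.

Lemma degree_ge_sub r S T : degree_ge r S -> degree_ge r T ->
  degree_ge r (fun f => S f - T f).
Proof. by move=> dS dT m f vf; apply: vanishesB; [apply: dS | apply: dT]. Qed.

Lemma degree_ge_opbr r s S T : degree_ge r S -> degree_ge s T -> degree_ge (r + s) (opbr S T).
Proof.
move=> dS dT; apply: degree_ge_sub; first exact: degree_ge_comp.
by rewrite addnC; apply: degree_ge_comp.
Qed.

Lemma magnus_m1_lcs k g : L k g -> degree_ge k.+1 (magnus_m1 g).
Proof.
elim: k g => [|k IH] g; first by move=> _; apply: magnus_degree1.
move: g; apply: gen_min (magnus_m1_subgrp _) _ => _ /comm_setE[a [c [_ Lc ->]]] m f vf.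
rewrite magnus_m1_cmg; apply: (degree_ge_opbr (magnus_degree1 a) (IH _ Lc)).
exact: magnus_degree0.
Qed.

Lemma magnus_m1_symbol k g T : symbol k g T -> degree_ge k.+1 (magnus_m1 g).
Proof.
move=> [_ dT dg] m f vf; rewrite -[magnus_m1 g f](subrK (T f)).
by apply: vanishesD; [apply: (degree_geW (leqnSn _) dg) | apply: dT].
Qed.

(** From $gh - 1 = (g-1)(h-1) + (g-1) + (h-1)$, whose first term has degree at least $2k+2$. *)
Lemma symbolM k g h S T : symbol k g S -> symbol k h T -> symbol k (g * h)%g (fun f => S f + T f).
Proof.
move=> gS hT; have hk := magnus_m1_symbol hT; have gk := magnus_m1_symbol gS.
case: gS hT => [SB dS dg] [TB dT dh]; split.
- by move=> f f'; rewrite SB TB opprD addrACA.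
- by move=> m f vf; apply: vanishesD; [apply: dS | apply: dT].
move=> m f vf; rewrite magnus_m1M.
rewrite [magnus h f]magnusE magnus_m1D.
have -> : magnus_m1 g (magnus_m1 h f) + magnus_m1 g f + magnus_m1 h f - (S f + T f) =
  magnus_m1 g (magnus_m1 h f) + ((magnus_m1 g f - S f) + (magnus_m1 h f - T f)).
  by apply/funext => w; rewrite !(addrfctE, opprfctE); lia.
apply: vanishesD; last by apply: vanishesD; [apply: dg | apply: dh].
by apply: vanishesW (degree_ge_comp gk hk vf); lia.
Qed.

Lemma symbol_lcs k g : L k.+1 g -> symbol k g (fun=> 0).
Proof.
move=> /magnus_m1_lcs dg; split; first by move=> f f'; rewrite subr0.
  by move=> m f vf w.
by move=> m f vf; rewrite subr0; apply: dg.
Qed.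

Lemma symbolV k g T : symbol k g T -> symbol k g^-1%g (fun f => - T f).
Proof.
move=> gT; have gk := magnus_m1_symbol gT; case: gT => TB dT dg; split.
- by move=> f f'; rewrite TB opprD.
- by move=> m f vf; apply: vanishesN; apply: dT.
move=> m f vf.
have E : magnus_m1 g^-1%g f = - magnus_m1 g^-1%g (magnus_m1 g f) - magnus_m1 g f.
  apply/funext => w; have := congr1 (fun F : V => F w) (magnus_m1M g^-1%g g f).
  by rewrite mulVg magnusE magnus_m1D !(addrfctE, sub_fctE, opprfctE) /magnus_m1 magnus1 subrr; lia.
rewrite E opprK -addrA; apply: vanishesD.
  apply: vanishesN; apply: vanishesW (degree_ge_comp (magnus_degree1 _) gk vf); lia.
rewrite -[- _ + _]opprK opprD opprK; apply: vanishesN; exact: dg.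
Qed.

Lemma symbol_cmg i j g h S T : symbol i g S -> symbol j h T ->
  symbol (i + j).+1 (cmg g h) (opbr S T).
Proof.
move=> gS hT; have hk := magnus_m1_symbol hT; have gk := magnus_m1_symbol gS.
case: gS hT => [SB dS dg] [TB dT dh]; split.
- exact: opbr_additive.
- by have := degree_ge_opbr dS dT; rewrite addnS.
move=> m f vf; rewrite magnus_m1_cmg [magnus _ f]magnusE.
set f1 := magnus_m1 _ f.
(* The factor $g^{-1}h^{-1}$ is 1 plus terms of positive degree, so it does not affect the leading
   part. *)
have vf1 : vanishes (1 + m) f1 by apply: magnus_degree1.
rewrite (additive_funD (opbr_additive (@magnus_m1B g) (@magnus_m1B h))) -addrA.
apply: vanishesD; first by apply: vanishesW (degree_ge_opbr gk hk vf1); lia.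
rewrite /opbr -[X in vanishes _ X]/(_ - _ - _).
have -> : magnus_m1 g (magnus_m1 h f) - magnus_m1 h (magnus_m1 g f) - (S (T f) - T (S f)) =
  (magnus_m1 g (magnus_m1 h f) - S (magnus_m1 h f)) + S (magnus_m1 h f - T f) -
  ((magnus_m1 h (magnus_m1 g f) - T (magnus_m1 g f)) + T (magnus_m1 g f - S f)).
  by rewrite (SB _ (T f)) (TB _ (S f)); apply/funext => w; rewrite !(addrfctE, opprfctE); lia.
apply: vanishesB; apply: vanishesD.
- by apply: vanishesW (degree_ge_comp dg hk vf); lia.
- by apply: vanishesW (degree_ge_comp dS dh vf); lia.
- by apply: vanishesW (degree_ge_comp dh gk vf); lia.
- by apply: vanishesW (degree_ge_comp dT dg vf); lia.
Qed.
Lemma symbol_tree (t : tree 'I_n) :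
  symbol (wtT (fun=> 0%N) t) (evT (@fg_x n : 'I_n -> lcsLie (FG n)) t)
    (evT (@lmul 'I_n : 'I_n -> opLie V) t).
Proof.
elim: t => [i|s IHs t IHt]; last exact: symbol_cmg.
split; [exact: lmulB | exact: lmul_degree | move=> m f vf w _].
by rewrite /magnus_m1 /= magnus_x addrAC addrK subrr.
Qed.

Lemma symbol_prodl k (u : seq (bool * tree 'I_n)) :
    alls (fun t => wtT (fun=> 0%N) t == k) u ->
  symbol k (prodl u (evT (@fg_x n : 'I_n -> lcsLie (FG n))))
    (ssum u (fun t => evT (@lmul 'I_n : 'I_n -> opLie V) t)).
Proof.
elim: u => [_|p u IH /= /andP[/eqP pk /IH pu]].
  by rewrite ssum_nil; apply/symbol_lcs/L1.
rewrite ssum_cons; apply: symbolM pu; have := symbol_tree p.2.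
rewrite pk => pS; by case: p.1 => //; apply: symbolV.
Qed.

Lemma size_leaves (A : Type) (t : tree A) : size (leaves t) = (wtT (fun=> 0%N) t).+1.
Proof. by elim: t => //= s IHs t IHt; rewrite size_cat IHs IHt addnS. Qed.

(** The hard half of Magnus's theorem. By induction [g] has a class in degree [k], represented by a
    combination [u] of bracketings; the leading part of [g] is the associative image of [u]. It
    vanishes, so the class is zero by [free_lie_injective]. *)
Theorem magnus_lcs k g :
  (forall v, (size v <= k)%N -> magnus g (@delta0 _) v = delta0 v) -> L k g.
Proof.
elim: k => [//|k IH] gk; have Lg : L k g by apply: IH => v vk; apply/gk/leqW.
have [u [uk eu]] := lcs_span (@fg_generated n) Lg.
have evL t : wtT (fun=> 0%N) t == k -> L k (evT (@fg_x n : 'I_n -> lcsLie (FG n)) t).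
  by move/eqP<-; apply: (@mem_evT (lcsLie (FG n)) 'I_n (fun=> 0%N) (@fg_x n) (fun=> I) t).
have Lu := prodl_mem evL uk.
have e : eqm k.+1 g (prodl u (evT (@fg_x n : 'I_n -> lcsLie (FG n)))).
  by apply/(sq_prP (d := lcs_quo _ k) Lg Lu); rewrite (pr_prodl evL uk).
have u0 : assoc_zero u.
  apply: lmul_assoc_zero => v.
  have [vk|vk] := eqVneq (size v) k.+1.
    (* Here [g] is a deeper element, with symbol zero, times the product representing [u]. *)
    have gS := symbolM (symbol_lcs e) (symbol_prodl uk).
    rewrite mulgVK in gS; case: gS => _ _ /(_ 0%N (@delta0 _)) gS.
    have := gS (fun _ => fun lt0 => False_ind _ (notF lt0)) v.
    rewrite vk addn0 => /(_ (ltnSn _)); rewrite sub_fctE add0r /magnus_m1 sub_fctE gk ?vk //.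
    by rewrite subrr sub0r !ssum_fct => /eqP; rewrite oppr_eq0 => /eqP.
  (* Words of any other length do not occur, since every tree of [u] has [k.+1] leaves. *)
  rewrite -[RHS](ssum0 _ u); apply: (eq_ssum_alls uk) => t /eqP tk.
  rewrite evT_words; last exact: lmulB.
  rewrite ssum_fct -[RHS](ssum0 _ (words t)); apply: (eq_ssum_alls (words_perm t)) => w.
  move=> /perm_size; rewrite foldr_lmul size_leaves tk => sw.
  by case: eqP => // wv; rewrite -wv sw eqxx in vk.
have ul : alls (fun t => size (leaves t) <= k.+1)%N u.
  by apply: sub_alls uk => t /eqP tk; rewrite size_leaves tk.
have := @free_lie_injective k.+1 _ (lcsLie (FG n)) (fun=> 0%N) (@fg_x n) k u (fun=> I) uk ul u0.
rewrite -eu => /= g0; have := (sq_prP (d := lcs_quo _ k) Lg (L1 _ _)).1.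
by rewrite invg1 mulg1; apply; rewrite sq_pr1; exact: g0.
Qed.
End Magnus.

Local Close Scope ring_scope.

(** * Triangular automorphisms *)

Section Automorphisms.
Local Open Scope group_scope.
Variable n : nat.
Local Notation F := (FG n).
Local Notation L := (lcs_aux (gops F) (fun=> True)).
Local Notation LA := (lcs_aux (AutOps n)).
Implicit Types (f g : F -> F) (x y : F) (S : (F -> F) -> Prop).

Lemma fg_hom_inv f g : fg_hom f -> cancel f g -> cancel g f -> fg_hom g.
Proof. by move=> fM fK gK x y; rewrite -{1}[x]gK -{1}[y]gK -fM fK. Qed.

Lemma fg_homM f : fg_hom f -> forall x y, f (x * y) = f x * f y.
Proof. by []. Qed.

Lemma isAut_comp f g : isAut f -> isAut g -> isAut (fun x => f (g x)).
Proof.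
move=> [fM fbij] [gM gbij]; split; last exact: bij_comp.
by move=> x y; rewrite gM fM.
Qed.

Lemma isAut_inv f g : isAut f -> cancel f g -> cancel g f -> isAut g.
Proof. by move=> [fM _] fK gK; split; [apply: fg_hom_inv fM fK gK | exists f]. Qed.

Lemma isAut_id : isAut (fun x : F => x).
Proof. by split=> //; exists id. Qed.

Definition autgrp S := [/\ S (fun x => x), forall f g, S f -> S g -> S (fun x => f (g x)) &
  forall f g, S f -> cancel f g -> cancel g f -> S g].

Lemma gen_aut S : autgrp (gen (AutOps n) S).
Proof.
split; [exact: gen_one | by move=> f g; apply: gen_mul |].
by move=> f g Sf fK gK; apply: gen_inv Sf _.
Qed.

Lemma gen_aut_min S S' : autgrp S' -> (forall f, S f -> S' f) ->
  forall f, gen (AutOps n) S f -> S' f.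
Proof.
move=> [S1 SM SV] sub f; elim=> {f} [|f /sub|f g _ Sf _ Sg|f g _ Sf [fK gK]] //.
  exact: SM.
exact: SV fK gK.
Qed.

Lemma lcs_aut S k : autgrp S -> autgrp (LA S k).
Proof. by case: k => [|k] //= _; apply: gen_aut. Qed.

Lemma lcs_aut_mono S S' k f : (forall f, S f -> S' f) -> LA S k f -> LA S' k f.
Proof.
move=> sub; elim: k f => [|k IH] f; first exact: sub.
apply: gen_aut_min (gen_aut _) _ f => _ [a [b [a' [b' [Sa Sb aK bK ->]]]]].
by apply: gen_S; exists a, b, a', b'; split; [apply: sub | apply: IH | ..].
Qed.

Lemma lcs_aut_sub S k f : autgrp S -> LA S k f -> S f.
Proof.
move=> Sgrp; elim: k f => [//|k IH]; apply: gen_aut_min (Sgrp) _.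
case: Sgrp => _ SM SV _ [a [b [a' [b' [Sa /IH Sb [aK a'K] [bK b'K] ->]]]]].
by apply: (SM); [apply: (SM); [apply: (SM)|]|] => //; [apply: SV aK _ | apply: SV bK _].
Qed.

(** This is $\mathcal A_{k+1}$, convertible to [Andreadakis k.+1]; the shift matches that of
    [lcs_aux]. *)
Definition acts_mod k f := isAut f /\ forall x, eqm k.+1 (f x) x.

Lemma acts_mod_generators k f : isAut f -> (forall i, eqm k.+1 (f (fg_x i)) (fg_x i)) ->
  acts_mod k f.
Proof.
move=> fA fx; split=> //; case: fA => fM _; have [f1 fV] := morph_one_inv fM.
apply: fg_generated fx; split=> [|x y ex ey|x ex].
- by rewrite f1; apply: eqm_refl.
- by rewrite fM; apply: eqmM.
- by rewrite fV; apply: eqmV.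
Qed.

Lemma acts_mod_lcs k f i x : acts_mod k f -> L i x -> eqm (i + k).+1 (f x) x.
Proof.
move=> [[fM _] fk]; have [f1 fV] := morph_one_inv fM.
elim: i x => [|i IH] x; first by move=> _; apply: fk.
move: x; apply: (@gen_min _ _ (fun x => eqm (i.+1 + k).+1 (f x) x)).
  split=> [|x y ex ey|x ex].
  - by rewrite f1; apply: eqm_refl.
  - by rewrite fM; apply: eqmM.
  - by rewrite fV; apply: eqmV.
move=> _ /comm_setE[a [c [_ Lc ->]]].
have -> : f (cmg a c) = cmg (f a) (f c) by rewrite /cmg !fM !fV.
have efc := IH _ Lc.
have Lfc : L i (f c) by apply: (eqm_mem _ Lc); apply: Lle efc; lia.
apply: (eqm_trans (y := cmg a (f c))).
  by have := cmg_eqml (fk a) Lfc; congr (eqm _ _ _); lia.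
by have := cmg_eqmr efc (I : L 0 a); congr (eqm _ _ _); lia.
Qed.

Lemma acts_mod_autgrp k : autgrp (acts_mod k).
Proof.
split.
- by split=> [|x]; [apply: isAut_id | apply: eqm_refl].
- move=> f g [fA fk] [gA gk]; split; first exact: isAut_comp.
  by move=> x; apply: eqm_trans (fk _) (gk _).
- move=> f g [fA fk] fK gK; split; first exact: isAut_inv fA fK gK.
  by move=> x; apply: eqm_sym; rewrite -{1}[x]gK.
Qed.

(** Put $y = f^{-1}g^{-1}x$, $f(y) = ay$ and $g(y) = by$. Then $f(g(y))$ and $g(f(y))$ are congruent
    to $bay$ and $aby$, and $[a,b]$ is deep enough. *)
Lemma acts_mod_comm i j f g f' g' : acts_mod i f -> acts_mod j g ->
    cancel f f' -> cancel f' f -> cancel g g' -> cancel g' g ->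
  acts_mod (i + j).+1 (fun x => f (g (f' (g' x)))).
Proof.
move=> fi gj fK f'K gK g'K.
have f'A := isAut_inv fi.1 fK f'K; have g'A := isAut_inv gj.1 gK g'K.
have [[fM fbij] fi'] := fi; have [[gM gbij] gj'] := gj.
split; first exact: (isAut_comp fi.1 (isAut_comp gj.1 (isAut_comp f'A g'A))).
move=> x; rewrite -[X in eqm _ _ X]g'K -[X in eqm _ _ (g X)]f'K.
move: (f' _) => y; set a := f y * y^-1; set b := g y * y^-1.
have ef : f y = a * y by rewrite mulgVK.
have eg : g y = b * y by rewrite mulgVK.
have La : L i.+1 a := fi' y.
have Lb : L j.+1 b := gj' y.
have fb : eqm (i + j).+2 (f b) b.
  by have := acts_mod_lcs fi Lb; congr (eqm _ _ _); lia.
have ga : eqm (i + j).+2 (g a) a.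
  by have := acts_mod_lcs gj La; congr (eqm _ _ _); lia.
rewrite eg ef fM gM ef eg; clearbody a b; apply: (eqm_trans (y := b * (a * y))).
  by apply: eqmM fb (eqm_refl _ _).
apply: eqm_sym; apply: (eqm_trans (y := a * (b * y))).
  by apply: eqmM ga (eqm_refl _ _).
rewrite !mulgA; apply: eqmM (eqm_refl _ _).
rewrite /eqm invgM !mulgA; apply: Lle (L_cmg La Lb); lia.
Qed.

Lemma IA_acts_mod f : IA f <-> acts_mod 0 f.
Proof. by []. Qed.

Lemma lcs_IA_acts_mod k f : LA (@IA n) k f -> acts_mod k f.
Proof.
elim: k f => [|k IH] f; first by move/IA_acts_mod.
apply: gen_aut_min (acts_mod_autgrp _) _ f.
move=> _ [a [b [a' [b' [/IA_acts_mod Sa /IH Sb [aK a'K] [bK b'K] ->]]]]].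
exact: (acts_mod_comm Sa Sb).
Qed.

(** * The subgroups generated by initial segments of the basis *)

Local Notation Fs := (@Fsub n).
Local Notation Ls m := (lcs_aux (gops F) (Fs m)).

Lemma Fsub_subgrp m : subgrp (Fs m). Proof. exact: (@gen_subgrp F). Qed.
Lemma Fsub1 m : Fs m 1. Proof. by case: (Fsub_subgrp m). Qed.
Lemma FsubM m x y : Fs m x -> Fs m y -> Fs m (x * y).
Proof. by case: (Fsub_subgrp m) => _ + _; apply. Qed.
Lemma FsubV m x : Fs m x -> Fs m x^-1. Proof. by case: (Fsub_subgrp m) => _ _; apply. Qed.
Lemma Fsub_cmg m x y : Fs m x -> Fs m y -> Fs m (cmg x y).
Proof.
by move=> Fx Fy; apply: FsubM; [apply: FsubM; [apply: FsubM|]|] => //; apply: FsubV.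
Qed.
Lemma Fsub_x m (i : 'I_n) : i < m -> Fs m (fg_x i).
Proof. by move=> im; apply: gen_S; exists i. Qed.

Lemma Fsub_min m (P : F -> Prop) : subgrp P -> (forall i : 'I_n, i < m -> P (fg_x i)) ->
  forall x, Fs m x -> P x.
Proof. by move=> Pgrp Px; apply: (@gen_min F) => // _ [i [im ->]]; apply: Px. Qed.

Lemma Fsub_hom m m' f : fg_hom f -> (forall i : 'I_n, i < m -> Fs m' (f (fg_x i))) ->
  forall x, Fs m x -> Fs m' (f x).
Proof.
move=> fM fx; have [f1 fV] := morph_one_inv fM.
apply: (@Fsub_min m (fun x => Fs m' (f x))) => //; split=> [|x y|x].
- by rewrite f1; apply: Fsub1.
- by rewrite fM; apply: FsubM.
- by rewrite fV; apply: FsubV.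
Qed.

Lemma Fsub_fix m f : fg_hom f -> (forall i : 'I_n, i < m -> f (fg_x i) = fg_x i) ->
  forall x, Fs m x -> f x = x.
Proof.
move=> fM fx; have [f1 fV] := morph_one_inv fM.
apply: (@Fsub_min m (fun x => f x = x)) => //; split=> // [x y ex ey|x ex].
- by rewrite fM ex ey.
- by rewrite fV ex.
Qed.

Lemma FsubW m m' x : m <= m' -> Fs m x -> Fs m' x.
Proof.
by move=> le; apply: (@Fsub_hom _ _ (fun x => x)) => // i im; apply/Fsub_x/(leq_trans im).
Qed.

Lemma Fsub_all x : Fs n x.
Proof.
by move: x; apply: fg_generated (Fsub_subgrp n) _ => i; apply: Fsub_x.
Qed.

Lemma lcs_Fsub m k x : Ls m k x -> Fs m x.
Proof. exact: (lcs_sub (Fsub_subgrp m)). Qed.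

Lemma lcs_Fsub_lcs m k x : Ls m k x -> L k x.
Proof. by apply: (lcs_hom (f := fun x => x)). Qed.

Definition retr m : F -> F := fg_ext (fun i : 'I_n => if i < m then fg_x i else 1).

Lemma retr_hom m : fg_hom (retr m). Proof. exact: fg_extM. Qed.

Lemma retr_Fsub m x : Fs m (retr m x).
Proof.
apply: Fsub_hom (Fsub_all x) => [|i _]; first exact: retr_hom.
by rewrite /retr fg_ext_x; case: ifP => [/Fsub_x //|_]; apply: Fsub1.
Qed.

Lemma retr_id m x : Fs m x -> retr m x = x.
Proof.
by apply: Fsub_fix => [|i im]; [apply: retr_hom | rewrite /retr fg_ext_x im].
Qed.

Lemma retr_lcs m k x : L k x -> Ls m k (retr m x).
Proof.
apply: lcs_hom => [||y _]; [exact: retr_hom | exact: Fsub_subgrp | exact: retr_Fsub].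
Qed.

(** Killing the generators of index at least [m] is a retraction onto $F_m$ and preserves lower
    central terms. *)
Lemma lcs_retract m k x : Fs m x -> L k x -> Ls m k x.
Proof. by move=> Fx /(@retr_lcs m); rewrite retr_id. Qed.

(** Apart from its constant term 1, the expansion of [w] has only words beginning with letters below
    [m]. *)
Lemma magnus_Fsub (m : 'I_n) w : Fs m w -> forall h v, magnus w h (m :: v) = h (m :: v).
Proof.
apply: (@Fsub_min m (fun w => forall h v, magnus w h (m :: v) = h (m :: v))).
  split=> // [x y ex ey h v|x ex h v]; first by rewrite magnusM ex ey.
  by rewrite -[LHS]ex -magnusM mulgV magnus1.
move=> i im h v; rewrite magnus_x addrfctE /=; case: eqP => [mi|_]; last exact: GRing.addr0.
by rewrite mi ltnn in im.
Qed.

(** In $xw = w(ex)$ the coefficient at $X_m v$ is that of $w$ at $v$ on the left, and that of 1 at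
    $v$ on the right when [v] has length at most [k]. *)
Lemma cmg_x_lcs (m : 'I_n) w k : Fs m w ->
  L k.+1 (w^-1 * fg_x m * w * (fg_x m)^-1) -> L k w.
Proof.
move=> Fw; set x := fg_x m; set e := _ * x^-1 => Le; apply: magnus_lcs => v vk.
have xw : x * w = w * (e * x) by rewrite /e !gnorm.
clearbody e.
have e0 : magnus_m1 e (magnus x (@delta0 _)) (m :: v) = 0%R.
  by apply: (@magnus_m1_lcs _ k.+1 e Le 0%N) => [?|]; rewrite ?ltn0 // addn0 !ltnS.
have := congr1 (fun h => magnus h (@delta0 _) (m :: v)) xw.
rewrite /= !magnusM (magnus_Fsub Fw) [magnus e _]magnusE addrfctE e0 GRing.add0r.
rewrite !magnus_x !addrfctE (magnus_Fsub Fw) /= eqxx.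
exact: GRing.addrI.
Qed.

(** * Elementary triangular automorphisms: $k_w$ is [tri m w^-1 w] and $t_c$ is [tri m 1 c] *)

Definition tri (m : 'I_n) (u v : F) : F -> F :=
  fg_ext (fun i : 'I_n => if i == m then u * fg_x m * v else fg_x i).

Lemma tri_hom m u v : fg_hom (tri m u v). Proof. exact: fg_extM. Qed.
Lemma tri_x m u v : tri m u v (fg_x m) = u * fg_x m * v.
Proof. by rewrite /tri fg_ext_x eqxx. Qed.
Lemma tri_neq m u v (i : 'I_n) : i != m -> tri m u v (fg_x i) = fg_x i.
Proof. by move=> /negPf im; rewrite /tri fg_ext_x im. Qed.
Lemma tri_fix (m : 'I_n) u v x : Fs m x -> tri m u v x = x.
Proof.
apply: Fsub_fix => [|i im]; first exact: tri_hom.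
by apply: tri_neq; rewrite -val_eqE ltn_eqF.
Qed.

Lemma tri_comp (m : 'I_n) u v u' v' : Fs m u' -> Fs m v' ->
  (fun x => tri m u v (tri m u' v' x)) = tri m (u' * u) (v * v').
Proof.
move=> Fu Fv; apply/funext; apply: fg_hom_ext => [x y|x y|i].
- by rewrite !tri_hom.
- exact: tri_hom.
have [->|im] := eqVneq i m; last by rewrite !tri_neq.
by rewrite !tri_x !(fg_homM (tri_hom _ _ _)) (tri_fix _ _ Fu) (tri_fix _ _ Fv) tri_x !mulgA.
Qed.

Lemma tri_compE (m : 'I_n) u v u' v' x : Fs m u' -> Fs m v' ->
  tri m u v (tri m u' v' x) = tri m (u' * u) (v * v') x.
Proof. by move=> Fu Fv; rewrite -tri_comp. Qed.

Lemma tri1 m : tri m 1 1 = id.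
Proof.
apply/funext; apply: fg_hom_ext => // [|i]; first exact: tri_hom.
by have [->|im] := eqVneq i m; [rewrite tri_x mul1g mulg1 | rewrite tri_neq].
Qed.

Lemma triK (m : 'I_n) u v : Fs m u -> Fs m v -> cancel (tri m u v) (tri m u^-1 v^-1).
Proof.
by move=> Fu Fv x; have := congr1 (@^~ x) (tri_comp u^-1 v^-1 Fu Fv); rewrite mulgV mulVg tri1.
Qed.

Lemma triVK (m : 'I_n) u v : Fs m u -> Fs m v -> cancel (tri m u^-1 v^-1) (tri m u v).
Proof. by move=> Fu Fv x; rewrite -{1}[u]invgK -{1}[v]invgK triK //; apply: FsubV. Qed.

Lemma tri_aut (m : 'I_n) u v : Fs m u -> Fs m v -> isAut (tri m u v).
Proof.
move=> Fu Fv; split; first exact: tri_hom.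
by exists (tri m u^-1 v^-1); [apply: triK | apply: triVK].
Qed.

Lemma tri_IAplus (m : 'I_n) u v : Fs m u -> Ls m 1 (u * v) -> IAplus (tri m u v).
Proof.
move=> Fu Luv; have Fv : Fs m v.
  by rewrite -[v](mulKg u); apply: FsubM; [apply: FsubV | apply: (lcs_Fsub Luv)].
split=> [|i]; first exact: tri_aut.
have [->|im] := eqVneq i m.
  exists u^-1, (u * v); split; [exact: FsubV | exact: Luv |].
  rewrite tri_x; change (u * fg_x m * v = u^-1^-1 * fg_x m * u^-1 * (u * v)).
  by rewrite !gnorm.
exists 1, 1; split; first exact: Fsub1.
  by case: (@lcs_subgrp F _ 1 (Fsub_subgrp i)).
rewrite tri_neq //; change (fg_x i = 1^-1 * fg_x i * 1 * 1).
by rewrite !gnorm.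
Qed.

Lemma IAplus_acts_mod f : IAplus f -> acts_mod 0 f.
Proof.
move=> [fA fx]; apply: acts_mod_generators => // i.
have [w [c [_ /lcs_Fsub_lcs Lc ->]]] := fx i.
rewrite -[X in eqm _ _ X]mulg1.
change (eqm 1 (w^-1 * fg_x i * w * c) (fg_x i * 1)).
apply: eqmM; last exact/eqm1.
rewrite -{2}[w]invgK; exact: eqm_conj.
Qed.

Lemma IAplus_Fsub f m : IAplus f -> forall x, Fs m x -> Fs m (f x).
Proof.
move=> [[fM _] fx]; apply: Fsub_hom => // i im.
have [w [c [Fw /lcs_Fsub Fc ->]]] := fx i.
apply: FsubM; last exact: (FsubW (ltnW im) Fc).
apply: FsubM; last exact: (FsubW (ltnW im) Fw).
by apply: FsubM; [apply/FsubV/(FsubW (ltnW im) Fw) | apply: Fsub_x].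
Qed.

Lemma IAplus_comp f g : IAplus f -> IAplus g -> IAplus (fun x => f (g x)).
Proof.
move=> fP gP; split=> [|i]; first exact: isAut_comp fP.1 gP.1.
have fF := IAplus_Fsub fP; case: fP => [[fM fbij] fx].
have {}fM := fg_homM fM; have [f1 fV] := morph_one_inv fM.
have [w [c [Fw Lc ->]]] := gP.2 i; have [w' [c' [Fw' Lc' fxi]]] := fx i.
(* From $f(x_i^w c) = (x_i^{w'} c')^{f(w)} f(c)$. *)
exists (w' * f w), ((f w)^-1 * c' * f w * f c); split.
- by apply: FsubM => //; apply: fF.
- have [_ LM LV] := @lcs_subgrp F _ 1 (Fsub_subgrp i).
  have Lfc : Ls i 1 (f c) by apply: lcs_hom Lc => //; [apply: Fsub_subgrp | apply: fF].
  apply: (LM) => //.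
  have conjM (x y : F) : (f w)^-1 * (x * y) * f w = (f w)^-1 * x * f w * ((f w)^-1 * y * f w).
    by rewrite !gnorm.
  apply: (lcs_hom (f := fun x : F => (f w)^-1 * x * f w) conjM _ _ Lc').
    exact: Fsub_subgrp.
  move=> x Fx; apply: FsubM; last exact: fF.
  by apply: FsubM => //; apply/FsubV/fF.
change (f (w^-1 * fg_x i * w * c) =
  (w' * f w)^-1 * fg_x i * (w' * f w) * ((f w)^-1 * c' * f w * f c)).
rewrite !fM fV fxi.
change ((f w)^-1 * (w'^-1 * fg_x i * w' * c') * f w * f c =
  (w' * f w)^-1 * fg_x i * (w' * f w) * ((f w)^-1 * c' * f w * f c)).
by rewrite !gnorm.
Qed.

Lemma IAplus_inv f g : IAplus f -> cancel f g -> cancel g f -> IAplus g.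
Proof.
move=> fP fK gK; have gA := isAut_inv fP.1 fK gK; split=> // i.
have gM := fg_homM gA.1; have [g1 gV] := morph_one_inv gM.
have gx (j : 'I_n) w c : f (fg_x j) = fg_conj (fg_x j) w * c ->
    g (fg_x j) = g w * fg_x j * (g w)^-1 * (g w * (g c)^-1 * (g w)^-1).
  move=> fx; have : f (fg_x j) = w^-1 * fg_x j * w * c by [].
  move/(congr1 g); rewrite fK !gM gV => e; by rewrite [in X in _ = g w * X * _ * _]e !gnorm.
(* The formula [gx] for $g(x_j)$ involves $g$ only on $F_j$, so $g$ preserves each $F_m$ by
   induction on [m]. *)
have gF m : m <= n -> forall x, Fs m x -> Fs m (g x).
  elim: m => [_|m IH mn]; first by apply: Fsub_hom.
  have {}IH := IH (ltnW mn).
  apply: Fsub_hom => // j; rewrite ltnS leq_eqVlt => /orP[/eqP jm|jm]; last first.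
    by apply: (FsubW (leqnSn m)); apply: IH; apply: Fsub_x.
  have [w [c [Fw /lcs_Fsub Fc /gx ->]]] := fP.2 j; rewrite jm in Fw Fc.
  have Fgw := FsubW (leqnSn m) (IH _ Fw); have Fgc := FsubW (leqnSn m) (IH _ Fc).
  have Fj : Fs m.+1 (fg_x j) by apply: Fsub_x; rewrite jm.
  by do ?[apply: FsubM | apply: FsubV].
have {}gF := gF i (ltnW (ltn_ord i)).
have [w [c [Fw Lc /gx ->]]] := fP.2 i.
exists (g w)^-1, (g w * (g c)^-1 * (g w)^-1); split.
- by apply/FsubV/gF.
- have conjM (x y : F) : g w * (x * y) * (g w)^-1 = g w * x * (g w)^-1 * (g w * y * (g w)^-1).
    by rewrite !gnorm.
  apply: (lcs_hom (f := fun x : F => g w * x * (g w)^-1) conjM (S := Fs i)).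
  + exact: Fsub_subgrp.
  + by move=> x Fx; do ?[apply: FsubM | apply: FsubV]; rewrite //; apply: gF.
  + have [_ _ LV] := @lcs_subgrp F _ 1 (Fsub_subgrp i); apply: LV.
    by apply: lcs_hom Lc => //; apply: Fsub_subgrp.
by rewrite -{1}[g w]invgK.
Qed.

Lemma IAplus_autgrp : autgrp (@IAplus n).
Proof.
split; [| exact: IAplus_comp | exact: IAplus_inv].
split=> [|i]; first exact: isAut_id.
exists 1, 1; split; first exact: Fsub1.
  by case: (@lcs_subgrp F _ 1 (Fsub_subgrp i)).
change (fg_x i = 1^-1 * fg_x i * 1 * 1).
by rewrite !gnorm.
Qed.

(** The map $w \mapsto k_w$ is a homomorphism from $F_m$ to $IA_n^+$, so it respects lower central
    series. *)
Lemma tri_conj_lcs (m : 'I_n) k w : Ls m k w -> LA (@IAplus n) k (tri m w^-1 w).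
Proof.
elim: k w => [|k IH] w Lw.
  apply: tri_IAplus; first exact: FsubV.
  by rewrite mulVg; case: (@lcs_subgrp F _ 1 (Fsub_subgrp m)).
suff [] : Fs m w /\ LA (@IAplus n) k.+1 (tri m w^-1 w) by [].
have [A1 AM AV] := lcs_aut k.+1 IAplus_autgrp; have [_ FM FV] := Fsub_subgrp m.
move: w Lw; apply: (@gen_min F _ (fun w => Fs m w /\ LA (@IAplus n) k.+1 (tri m w^-1 w))).
  split=> [|x y [Fx Lx] [Fy Ly]|x [Fx Lx]].
  - by split; [apply: Fsub1 | rewrite invg1 tri1].
  - split; first exact: FM.
    by rewrite invgM -tri_comp //; [apply: AM | apply: FV].
  - split; first exact: FV.
    by apply: (AV _ _ Lx); [apply: triK | apply: triVK] => //; apply: FV.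
move=> _ /comm_setE[a [c [Fa Lc ->]]]; have Fc := lcs_Fsub Lc.
have Fac := Fsub_cmg Fa Fc.
split=> //; apply: gen_S.
exists (tri m a^-1 a), (tri m c^-1 c), (tri m a^-1^-1 a^-1), (tri m c^-1^-1 c^-1); split.
- apply: tri_IAplus; first exact: FV.
  by rewrite mulVg; case: (@lcs_subgrp F _ 1 (Fsub_subgrp m)).
- exact: IH.
- by split; [apply: triK | apply: triVK] => //; apply: FV.
- by split; [apply: triK | apply: triVK] => //; apply: FV.
apply/funext => x /=.
have [Fa' Fc'] := (FsubV Fa, FsubV Fc); have [Fa'' Fc''] := (FsubV Fa', FsubV Fc').
by rewrite !tri_compE // /cmg !gnorm.
Qed.

(** Induction by $[k_a, t_c] = t_{[a,c]}$. The index shifts by one because $t_c$ is already in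
    $IA_n^+$ for $c$ in $\Gamma_2(F_m)$. *)
Lemma tri_right_lcs (m : 'I_n) k c : Ls m k.+1 c -> LA (@IAplus n) k (tri m 1 c).
Proof.
elim: k c => [|k IH] c Lc.
  by apply: tri_IAplus; [apply: Fsub1 | rewrite mul1g].
suff [] : Fs m c /\ LA (@IAplus n) k.+1 (tri m 1 c) by [].
have [A1 AM AV] := lcs_aut k.+1 IAplus_autgrp; have [F1 FM FV] := Fsub_subgrp m.
move: c Lc; apply: (@gen_min F _ (fun c => Fs m c /\ LA (@IAplus n) k.+1 (tri m 1 c))).
  split=> [|x y [Fx Lx] [Fy Ly]|x [Fx Lx]].
  - by split; [apply: Fsub1 | rewrite tri1].
  - split; first exact: FM.
    by rewrite -{1}[1]mulg1 -tri_comp //; apply: AM.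
  - split; first exact: FV.
    by rewrite -invg1; apply: (AV _ _ Lx); [apply: triK | apply: triVK].
move=> _ /comm_setE[a [c [Fa Lc ->]]]; have Fc := @lcs_Fsub m k.+1 c Lc.
have Fac := Fsub_cmg Fa Fc.
split=> //; apply: gen_S.
exists (tri m a^-1 a), (tri m 1 c), (tri m a^-1^-1 a^-1), (tri m 1^-1 c^-1); split.
- apply: tri_IAplus; first exact: FV.
  by rewrite mulVg; case: (@lcs_subgrp F _ 1 (Fsub_subgrp m)).
- exact: IH.
- by split; [apply: triK | apply: triVK] => //; apply: FV.
- by split; [apply: triK | apply: triVK].
apply/funext => x /=.
have [Fa' Fc'] := (FsubV Fa, FsubV Fc); have [Fa'' Fc''] := (FsubV Fa', FsubV Fc').
by rewrite !tri_compE // /cmg !gnorm.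
Qed.

(** The truncation of [f] to the first [m] generators; it builds [f] up from the identity one
    generator at a time. *)
Definition aut_part f (m : nat) : F -> F :=
  fg_ext (fun i : 'I_n => if i < m then f (fg_x i) else fg_x i).

Lemma aut_part_step f (m : 'I_n) w c : IAplus f -> Fs m w -> Fs m c ->
    f (fg_x m) = w^-1 * fg_x m * w * c ->
  aut_part f m.+1 = (fun x => tri m w^-1 w (tri m 1 c (aut_part f m x))).
Proof.
move=> fP Fw Fc fm; apply/funext; apply: fg_hom_ext => [||i].
- exact: fg_extM.
- by move=> x y; rewrite [aut_part f m _]fg_extM !tri_hom.
rewrite /aut_part !fg_ext_x ltnS; case: ltngtP => [im|im|/val_inj ->].
- rewrite !tri_fix //; apply: (FsubW im); apply: IAplus_Fsub => //; exact: Fsub_x.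
- by rewrite !tri_neq // -val_eqE gtn_eqF.
- by rewrite fm tri_x mul1g (fg_homM (tri_hom _ _ _)) tri_x [tri m _ _ c]tri_fix.
Qed.

Lemma IAplus_acts_mod_lcs k f : IAplus f -> acts_mod k f -> LA (@IAplus n) k f.
Proof.
move=> fP [_ fk].
have [A1 AM AV] := lcs_aut k IAplus_autgrp.
have part m : m <= n -> LA (@IAplus n) k (aut_part f m).
  elim: m => [_|m IH mn].
    suff -> : aut_part f 0 = id by [].
    by apply/funext; apply: fg_hom_ext => // [|i]; [apply: fg_extM | apply: fg_ext_x].
  pose M := Ordinal mn; have [w [c [Fw /lcs_Fsub Fc fM]]] := fP.2 M.
  have {}fM : f (fg_x M) = w^-1 * fg_x M * w * c by [].
  have Le := fk (fg_x M); rewrite /eqm fM in Le.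
  (* The retraction killing $x_m$ sends $f(x_m)x_m^{-1}$ to $c$. *)
  have Lc : Ls M k.+1 c.
    have [r1 rV] := morph_one_inv (@retr_hom M); have rM := fg_homM (@retr_hom M).
    move/(@retr_lcs M): (Le); rewrite !(rM, rV) !(retr_id Fw) (retr_id Fc).
    by rewrite /retr fg_ext_x /= ltnn !gnorm.
  have Lw : Ls M k w.
    apply: lcs_retract (Fw) _; apply: (cmg_x_lcs Fw).
    (* Cancelling $c$ from $f(x_m)x_m^{-1}$ leaves $w^{-1}x_m w x_m^{-1}$, as [cmg_x_lcs]
       requires. *)
    have := LM Le (LJ (fg_x M) (LV (lcs_Fsub_lcs Lc))); by rewrite !gnorm.
  rewrite -[m.+1]/(M.+1) (aut_part_step fP Fw Fc fM).
  apply: (AM (tri M w^-1 w)); first exact: tri_conj_lcs.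
  by apply: (AM (tri M 1 c)); [apply: tri_right_lcs | apply: IH; apply: ltnW].
suff <- : aut_part f n = f by apply: part.
apply/funext; apply: fg_hom_ext => [||i]; [exact: fg_extM | exact: fP.1.1 |].
by rewrite /aut_part fg_ext_x ltn_ord.
Qed.
End Automorphisms.

Theorem mainTheorem9 (n : nat) (hn : 0 < n) (j : nat) (hj : 0 < j)
  (f : FG n -> FG n) :
  (Gamma (AutOps n) j (@IAplus n) f <-> Gamma (AutOps n) j (@IA n) f /\ IAplus f) /\
  (Gamma (AutOps n) j (@IA n) f /\ IAplus f <-> @Andreadakis n j f /\ IAplus f).
Proof.
case: j hj => // k _; rewrite /Gamma /=.
(* With $j = k+1$, three inclusions close a cycle: $\Gamma_j(IA_n^+)$ lies in $\Gamma_j(IA_n) \cap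
   IA_n^+$, which lies in $\mathcal A_j \cap IA_n^+$, which lies in $\Gamma_j(IA_n^+)$. *)
have IA_And : lcs_aux (AutOps n) (@IA n) k f -> Andreadakis k.+1 f by apply: lcs_IA_acts_mod.
have And_plus : Andreadakis k.+1 f /\ IAplus f -> lcs_aux (AutOps n) (@IAplus n) k f.
  by case=> fk fP; apply: IAplus_acts_mod_lcs.
have plus_IA : lcs_aux (AutOps n) (@IAplus n) k f ->
    lcs_aux (AutOps n) (@IA n) k f /\ IAplus f.
  move=> fk; split; last exact: lcs_aut_sub (IAplus_autgrp n) fk.
  by apply: lcs_aut_mono fk => g /IAplus_acts_mod /IA_acts_mod.
split; split=> //.
- by move=> [/IA_And fA fP]; apply: And_plus.
- by move=> [/IA_And fA fP].
- by move=> fAP; apply/plus_IA/And_plus.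
Qed.
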